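(* Let $G$ be the fundamental group of a graph of groups $(\mathfrak{G},\Gamma)$ such that the image of each edge map $\mathfrak{G}(e)\to\mathfrak{G}(v)$ is left relatively convex in its vertex group $\mathfrak{G}(v)$. Then each vertex group is left relatively convex in $G$. If some vertex group is left orderable, then $G$ is left orderable. Moreover, if the input orders are given effectively, then the output orders are given effectively.
   Context: An order on a set is a transitive, trichotomous binary relation (a strict total order). A subgroup $H$ of a group $K$ is left relatively convex in $K$ if the left $K$-set $K/H$ of left cosets admits at least one $K$-invariant order. A group is left orderable if it admits an order invariant under left multiplication (a left order). A graph of groups $(\mathfrak{G},\Gamma)$ consists of a nonempty, connected (oriented) graph $\Gamma$, with each edge $e$ having an initial vertex $\iota e$ and a terminal vertex $\tau e$ (possibly equal), a group $\mathfrak{G}(v)$ for each vertex $v$ (vertex group), a group $\mathfrak{G}(e)$ for each edge $e$ (edge group), and, for each edge $e$, two injective group homomorphisms $\mathfrak{G}(e,\iota):\mathfrak{G}(e)\to\mathfrak{G}(\iota e)$ and $\mathfrak{G}(e,\tau):\mathfrak{G}(e)\to\mathfrak{G}(\tau e)$ (the edge maps). Its fundamental group is the usual one of Bass-Serre theory: choosing a maximal subtree $\Gamma_0$ of $\Gamma$, it is the quotient of the free product of all the vertex groups and the free group on symbols $t_e$ (one for each edge $e$) by the relations $t_e=1$ for $e$ in $\Gamma_0$, and $t_e^{-1}\cdot\mathfrak{G}(e,\iota)(c)\cdot t_e=\mathfrak{G}(e,\tau)(c)$ for every edge $e$ and every $c\in\mathfrak{G}(e)$. The natural maps from the vertex groups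 to the fundamental group are injective, and vertex groups are viewed as subgroups of $G$ via these maps. In the last sentence of the claim, the input orders are the orders whose existence is hypothesized (for each edge map, a $\mathfrak{G}(v)$-invariant order on the left cosets in $\mathfrak{G}(v)$ of the image of $\mathfrak{G}(e)$ and, for the left-orderability conclusion, a left order on some vertex group), and the output orders are the orders whose existence is concluded (a $G$-invariant order on the left cosets in $G$ of each vertex group and, for the left-orderability conclusion, a left order on $G$). ''Given effectively'' is used informally, in the sense of being explicitly constructed. *)

(* Defs.v *)
From HB Require Import structures.
From mathcomp Require Import all_boot boolp classical_sets.

Set Implicit Arguments.
Unset Strict Implicit.
Unset Printing Implicit Defensive.

Local Open Scope classical_set_scope.
Local Open Scope quotient_scope.
Local Open Scope group_scope.

Definition exactly_one (P Q R : Prop) : Prop :=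
  [\/ [/\ P, ~ Q & ~ R], [/\ ~ P, Q & ~ R] | [/\ ~ P, ~ Q & R]].

(* Only the values of lt on S matter. *)
Definition order_on (X : Type) (S : set X) (lt : X -> X -> Prop) : Prop :=
  (forall x y z, S x -> S y -> S z -> lt x y -> lt y z -> lt x z) /\
  (forall x y, S x -> S y -> exactly_one (lt x y) (x = y) (lt y x)).

Definition ltranslate (K : groupType) (k : K) (A : set K) : set K :=
  [set k * a | a in A].

Definition left_cosets (K : groupType) (H : set K) : set (set K) :=
  range (fun k : K => ltranslate k H).

Definition coset_order (K : groupType) (H : set K) (lt : set K -> set K -> Prop)
    : Prop :=
  order_on (left_cosets H) lt /\
  (forall (k : K) (A B : set K), left_cosets H A -> left_cosets H B ->
     lt A B -> lt (ltranslate k A) (ltranslate k B)).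

Definition left_relatively_convex (K : groupType) (H : set K) : Prop :=
  exists lt : set K -> set K -> Prop, coset_order H lt.

Definition left_order (K : groupType) (lt : K -> K -> Prop) : Prop :=
  order_on [set: K] lt /\ (forall k x y : K, lt x y -> lt (k * x) (k * y)).

Definition left_orderable (K : groupType) : Prop :=
  exists lt : K -> K -> Prop, left_order lt.

Record graph := Graph {
  vertex : Type;
  edge : Type;
  init : edge -> vertex;
  term : edge -> vertex }.

(* (e, true) is e traversed from init e to term e; (e, false) is e traversed
   backwards. *)
Definition dart (Gam : graph) : Type := (edge Gam * bool)%type.

Definition dart_src (Gam : graph) (d : dart Gam) : vertex Gam :=
  if d.2 then init d.1 else term d.1.

Definition dart_tgt (Gam : graph) (d : dart Gam) : vertex Gam :=
  if d.2 then term d.1 else init d.1.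

Fixpoint walk (Gam : graph) (E0 : set (edge Gam)) (v : vertex Gam)
    (p : seq (dart Gam)) (w : vertex Gam) : Prop :=
  if p is d :: p' then [/\ E0 d.1, dart_src d = v & walk E0 (dart_tgt d) p' w]
  else v = w.

Definition reduced (Gam : graph) (p : seq (dart Gam)) : Prop :=
  forall p1 p2 e b, p <> p1 ++ (e, b) :: (e, ~~ b) :: p2.

Definition connected_graph (Gam : graph) : Prop :=
  [set: vertex Gam] !=set0 /\
  (forall v w : vertex Gam, exists p, walk [set: edge Gam] v p w).

Record subtree (Gam : graph) (V0 : set (vertex Gam)) (E0 : set (edge Gam))
    : Prop := {
  subtree_ends : forall e, E0 e -> V0 (init e) /\ V0 (term e);
  subtree_nonempty : V0 !=set0;
  subtree_connected : forall v w, V0 v -> V0 w -> exists p, walk E0 v p w;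
  subtree_acyclic : forall v p, walk E0 v p v -> reduced p -> p = [::] }.

Definition maximal_subtree (Gam : graph) (V0 : set (vertex Gam))
    (E0 : set (edge Gam)) : Prop :=
  subtree V0 E0 /\
  (forall V1 E1, subtree V1 E1 -> V0 `<=` V1 -> E0 `<=` E1 ->
     V1 `<=` V0 /\ E1 `<=` E0).

Record graph_of_groups (Gam : graph) := GraphOfGroups {
  vgrp : vertex Gam -> groupType;
  egrp : edge Gam -> groupType;
  init_map : forall e, UMagmaMorphism.type (egrp e) (vgrp (init e));
  term_map : forall e, UMagmaMorphism.type (egrp e) (vgrp (term e));
  init_map_inj : forall e, injective (init_map e);
  term_map_inj : forall e, injective (term_map e) }.

Arguments init_map {Gam} g e.
Arguments term_map {Gam} g e.

Section FundamentalGroup.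
Variables (Gam : graph) (GG : graph_of_groups Gam) (E0 : set (edge Gam)).

(* Stab e true is the symbol t_e and Stab e false its formal inverse. *)
Inductive letter : Type :=
  | Elt (v : vertex Gam) (g : vgrp GG v)
  | Stab (e : edge Gam) (b : bool).

HB.instance Definition _ := Choice.copy letter {classic letter}.

Definition word : Type := seq letter.

(* The congruence on the free monoid of words generated by the relations of the
   free product of the vertex groups with the free group on the t_e, and by the
   defining relations of the fundamental group.  The quotient of a monoid in
   which every generator is invertible is the quotient group. *)
Inductive word_eq : word -> word -> Prop :=
  | word_refl w : word_eq w w
  | word_sym w1 w2 : word_eq w1 w2 -> word_eq w2 w1
  | word_trans w1 w2 w3 : word_eq w1 w2 -> word_eq w2 w3 -> word_eq w1 w3
  | word_cat u1 u2 w1 w2 :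
      word_eq u1 u2 -> word_eq w1 w2 -> word_eq (u1 ++ w1) (u2 ++ w2)
  | word_one v : word_eq [:: Elt (1 : vgrp GG v)] [::]
  | word_mul v (g h : vgrp GG v) : word_eq [:: Elt g; Elt h] [:: Elt (g * h)]
  | word_stabV e b : word_eq [:: Stab e b; Stab e (~~ b)] [::]
  | word_tree e : E0 e -> word_eq [:: Stab e true] [::]
  | word_conj e (c : egrp GG e) :
      word_eq [:: Stab e false; Elt (init_map GG e c); Stab e true]
              [:: Elt (term_map GG e c)].

Definition word_eqb : rel word := fun w1 w2 => `[< word_eq w1 w2 >].

Lemma word_eqb_refl : reflexive word_eqb.
Proof. by move=> w; apply/asboolP; exact: word_refl. Qed.

Lemma word_eqb_sym : symmetric word_eqb.
Proof. by move=> u w; apply/asboolP/asboolP => h; exact: word_sym. Qed.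

Lemma word_eqb_trans : transitive word_eqb.
Proof.
by move=> u w x /asboolP h1 /asboolP h2; apply/asboolP; exact: word_trans h2.
Qed.

Canonical word_equiv := EquivRel word_eqb word_eqb_refl word_eqb_sym word_eqb_trans.

Definition fundamental_group : Type := {eq_quot word_equiv}.

HB.instance Definition _ := Choice.on fundamental_group.

Definition word_class (w : word) : fundamental_group := \pi_{eq_quot word_equiv} w.

Lemma word_classP u w : word_class u = word_class w <-> word_eq u w.
Proof. by split=> [/eqmodP/asboolP // | h]; apply/eqmodP/asboolP. Qed.

Definition word_repr (x : fundamental_group) : word := repr x.

Lemma word_reprK x : word_class (word_repr x) = x.
Proof. exact: reprK. Qed.

Definition letter_inv (a : letter) : letter :=
  match a with Elt v g => Elt g^-1 | Stab e b => Stab e (~~ b) end.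

Definition word_inv (w : word) : word := rev (map letter_inv w).

Lemma word_inv_cat u w : word_inv (u ++ w) = word_inv w ++ word_inv u.
Proof. by rewrite /word_inv map_cat rev_cat. Qed.

Lemma word_inv_eq u w : word_eq u w -> word_eq (word_inv u) (word_inv w).
Proof.
elim=> {u w} [w|w1 w2 _ h|w1 w2 w3 _ h1 _ h2|u1 u2 w1 w2 _ h1 _ h2|v|v g h|e b|e he|e c].
- exact: word_refl.
- exact: word_sym.
- exact: word_trans h2.
- by rewrite !word_inv_cat; exact: word_cat.
- by rewrite /word_inv /= invg1; exact: word_one.
- by rewrite /word_inv /= invgM; exact: word_mul.
- by rewrite /word_inv /= negbK; have := word_stabV e b.
- apply: word_trans (word_stabV e false).
  rewrite -[X in word_eq X _]cats0 /=.
  exact: (word_cat (word_refl [:: Stab e false]) (word_sym (word_tree he))).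
- by rewrite /word_inv /= -!gmulfV; exact: word_conj.
Qed.

Lemma word_invK w : word_eq (word_inv w ++ w) [::].
Proof.
elim: w => [|a w IH]; first exact: word_refl.
rewrite -cat1s word_inv_cat -catA [_ ++ ([:: a] ++ w)]catA.
apply: word_trans IH; apply: word_cat; first exact: word_refl.
rewrite -[X in word_eq _ X]cat0s; apply: word_cat; last exact: word_refl.
case: a => [v g|e b]; rewrite /word_inv /=.
  by apply: word_trans (word_mul _ _) _; rewrite mulVg; exact: word_one.
by have := word_stabV e (~~ b); rewrite negbK.
Qed.

Lemma word_invKr w : word_eq (w ++ word_inv w) [::].
Proof.
have {1}-> : w = word_inv (word_inv w); last exact: word_invK.
rewrite /word_inv map_rev revK -map_comp map_id_in // => -[v g|e b] _ /=.
  by rewrite invgK.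
by rewrite negbK.
Qed.

Definition fg_one : fundamental_group := word_class [::].
Definition fg_mul (x y : fundamental_group) : fundamental_group :=
  word_class (word_repr x ++ word_repr y).
Definition fg_inv (x : fundamental_group) : fundamental_group :=
  word_class (word_inv (word_repr x)).

Lemma fg_mulE u w : fg_mul (word_class u) (word_class w) = word_class (u ++ w).
Proof.
by apply/word_classP; apply: word_cat; apply/word_classP; rewrite word_reprK.
Qed.

Lemma fg_invE u : fg_inv (word_class u) = word_class (word_inv u).
Proof.
by apply/word_classP; apply: word_inv_eq; apply/word_classP; rewrite word_reprK.
Qed.

Lemma fg_mulA : associative fg_mul.
Proof.
move=> x y z; rewrite -(word_reprK x) -(word_reprK y) -(word_reprK z).
by rewrite !fg_mulE catA.
Qed.

Lemma fg_mul1g : left_id fg_one fg_mul.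
Proof. by move=> x; rewrite -(word_reprK x) /fg_one fg_mulE. Qed.

Lemma fg_mulg1 : right_id fg_one fg_mul.
Proof. by move=> x; rewrite -(word_reprK x) /fg_one fg_mulE cats0. Qed.

Lemma fg_mulVg : left_inverse fg_one fg_inv fg_mul.
Proof.
move=> x; rewrite -(word_reprK x) fg_invE fg_mulE.
by apply/word_classP; exact: word_invK.
Qed.

Lemma fg_mulgV : right_inverse fg_one fg_inv fg_mul.
Proof.
move=> x; rewrite -(word_reprK x) fg_invE fg_mulE.
by apply/word_classP; exact: word_invKr.
Qed.

HB.instance Definition _ := isGroup.Build fundamental_group
  fg_mulA fg_mul1g fg_mulg1 fg_mulVg fg_mulgV.

(* The vertex group at v, viewed as a subgroup of the fundamental group. *)
Definition vertex_subgroup (v : vertex Gam) : set fundamental_group :=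
  range (fun g : vgrp GG v => word_class [:: Elt g]).

End FundamentalGroup.

Arguments Elt {Gam GG v} g.
Arguments word_class {Gam GG} E0 w.
Arguments vertex_subgroup {Gam} GG E0 v.
Arguments Stab {Gam GG} e b.

(* The total recursive functions relative to a set O of oracle functions (plain
   recursive functions for O = set0).  A function takes its arguments as a list
   and sees only finitely many of them, absent arguments being read as 0; it is
   thus only evaluated below at lists of a fixed length. *)
Inductive computable_in (O : set (nat -> nat)) : (seq nat -> nat) -> Prop :=
  | comp_oracle f : O f -> computable_in O (fun s => f (head 0%N s))
  | comp_zero : computable_in O (fun=> 0%N)
  | comp_succ : computable_in O (fun s => (head 0%N s).+1)
  | comp_proj i : computable_in O (fun s => nth 0%N s i)
  | comp_comp f (gs : seq (seq nat -> nat)) :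
      computable_in O f -> (forall i, computable_in O (nth (fun=> 0%N) gs i)) ->
      computable_in O (fun s => f [seq g s | g <- gs])
  | comp_rec f g : computable_in O f -> computable_in O g ->
      computable_in O (fun s =>
        nat_rect (fun=> nat) (f (behead s)) (fun k r => g [:: k, r & behead s])
          (head 0%N s))
  | comp_mu f (f0 : forall s, exists k, f (k :: s) == 0%N) :
      computable_in O f -> computable_in O (fun s => ex_minn (f0 s)).

Section Effectivity.
Variables (O : set (nat -> nat)) (Gam : graph) (GG : graph_of_groups Gam)
  (E0 : set (edge Gam)).

(* Codes for the elements of the sets that make up (GG, Gam, E0); effectivity of
   an order on such a set only makes sense relative to them. *)
Record coding := Coding {
  vcode : vertex Gam -> nat;
  ecode : edge Gam -> nat;
  vgcode : forall v, vgrp GG v -> nat;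
  egcode : forall e, egrp GG e -> nat;
  vcode_inj : injective vcode;
  ecode_inj : injective ecode;
  vgcode_inj : forall v, injective (@vgcode v);
  egcode_inj : forall e, injective (@egcode e) }.

Variable C : coding.

(* The code sets and all the structure are computable, uniformly in the vertices
   and edges: the vertex and edge groups are uniformly computable groups. *)
Record effective_coding : Prop := EffectiveCoding {
  eff_vertex : exists2 f, computable_in O f &
    forall m, f [:: m] = `[< exists v, m = vcode C v >];
  eff_edge : exists2 f, computable_in O f &
    forall m, f [:: m] = `[< exists e, m = ecode C e >];
  eff_vgrp : exists2 f, computable_in O f & forall m n, f [:: m; n] =
    `[< exists v (g : vgrp GG v), m = vcode C v /\ n = vgcode C g >];
  eff_egrp : exists2 f, computable_in O f & forall m n, f [:: m; n] =
    `[< exists e (c : egrp GG e), m = ecode C e /\ n = egcode C c >];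
  eff_init : exists2 f, computable_in O f &
    forall e, f [:: ecode C e] = vcode C (init e);
  eff_term : exists2 f, computable_in O f &
    forall e, f [:: ecode C e] = vcode C (term e);
  eff_tree : exists2 f, computable_in O f &
    forall e, f [:: ecode C e] = `[< E0 e >];
  eff_vmul : exists2 f, computable_in O f & forall v (g h : vgrp GG v),
    f [:: vcode C v; vgcode C g; vgcode C h] = vgcode C (g * h);
  eff_emul : exists2 f, computable_in O f & forall e (c d : egrp GG e),
    f [:: ecode C e; egcode C c; egcode C d] = egcode C (c * d);
  eff_init_map : exists2 f, computable_in O f & forall e (c : egrp GG e),
    f [:: ecode C e; egcode C c] = vgcode C (init_map GG e c);
  eff_term_map : exists2 f, computable_in O f & forall e (c : egrp GG e),
    f [:: ecode C e; egcode C c] = vgcode C (term_map GG e c) }.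

Definition letter_code (a : letter GG) : nat :=
  match a with
  | Elt v g => CodeSeq.code [:: 0; vcode C v; vgcode C g]%N
  | Stab e b => CodeSeq.code [:: 1; ecode C e; b : nat]%N
  end.

Definition word_code (w : word GG) : nat := CodeSeq.code (map letter_code w).

(* An order on cosets (respectively elements) is effective when it is decidable,
   uniformly in the vertex or edge, from codes of representatives; elements of
   the fundamental group are represented by words. *)
Definition effective_init_orders
    (lt : forall e, set (vgrp GG (init e)) -> set (vgrp GG (init e)) -> Prop)
    : Prop :=
  exists2 f, computable_in O f & forall e (g h : vgrp GG (init e)),
    f [:: ecode C e; vgcode C g; vgcode C h] =
    `[< lt e (ltranslate g (range (init_map GG e)))
             (ltranslate h (range (init_map GG e))) >].

Definition effective_term_orders
    (lt : forall e, set (vgrp GG (term e)) -> set (vgrp GG (term e)) -> Prop)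
    : Prop :=
  exists2 f, computable_in O f & forall e (g h : vgrp GG (term e)),
    f [:: ecode C e; vgcode C g; vgcode C h] =
    `[< lt e (ltranslate g (range (term_map GG e)))
             (ltranslate h (range (term_map GG e))) >].

Definition effective_vertex_left_order (v : vertex Gam)
    (lt : vgrp GG v -> vgrp GG v -> Prop) : Prop :=
  exists2 f, computable_in O f & forall g h : vgrp GG v,
    f [:: vgcode C g; vgcode C h] = `[< lt g h >].

Definition effective_output_orders
    (lt : vertex Gam -> set (fundamental_group GG E0) ->
          set (fundamental_group GG E0) -> Prop) : Prop :=
  exists2 f, computable_in O f & forall v (u w : word GG),
    f [:: vcode C v; word_code u; word_code w] =
    `[< lt v (ltranslate (word_class E0 u) (vertex_subgroup GG E0 v))
             (ltranslate (word_class E0 w) (vertex_subgroup GG E0 v)) >].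

Definition effective_left_order
    (lt : fundamental_group GG E0 -> fundamental_group GG E0 -> Prop) : Prop :=
  exists2 f, computable_in O f & forall u w : word GG,
    f [:: word_code u; word_code w] =
    `[< lt (word_class E0 u) (word_class E0 w) >].

End Effectivity.

(* Main.v *)
Require Import Defs.
From HB Require Import structures.
From Stdlib Require Import ZArith Lia.
From mathcomp Require Import all_boot.
From mathcomp Require Import boolp classical_sets wochoice.

Set Implicit Arguments.
Unset Strict Implicit.
Unset Printing Implicit Defensive.

(* Reduced paths of the graph of groups are geodesics of the Bass-Serre tree.
   The given coset orders, combined with a total order of the oriented edges,
   order the edges issuing from each vertex of the tree.  To a geodesic attach
   the integer [Phi] obtained by adding a sign for each of its edges (forwards
   or backwards) and a sign for each of its interior vertices (according to the
   order of the incoming and outgoing edges).  It has an odd number of terms,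
   hence is nonzero unless the geodesic is trivial, it changes sign when the
   geodesic is reversed, and along the three sides of a tripod it is additive up
   to the error of one cyclically compared triple of edges, which is at most 1.
   Thus the elements [x] for which the geodesic from the base vertex [v] to [x v]
   has [Phi > 0] form a positive cone relative to the vertex group of [v].  A left
   order of that vertex group then extends lexicographically.

   [Phi] is well defined because a nonempty reduced path is never trivial in the
   fundamental group, which follows from the action on normal forms.  For
   effectivity, one searches for a path word that differs from the given word
   only by letters of the maximal tree, reduces it with a stack machine, and
   evaluates [Phi]. *)

(** * Positive cones relative to a subgroup *)

Section Cone.
Variable K : groupType.
Local Open Scope group_scope.
Local Open Scope classical_set_scope.

(** The tree itself is never built: a path is a list of darts and group elements with a value in the
    fundamental group, and uniqueness of geodesics is replaced by the single fact that a reduced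
    path of value 1 is empty. Path elements live in the product of all vertex groups, and this
    forces two versions of an edge subgroup. Comparing edges requires trichotomy on the whole
    product, hence the cylinder of all elements whose coordinate lies in the edge group. Normal
    forms require isomorphic subgroups at the two ends of an edge, hence only the elements supported
    on one coordinate. With the latter the edges become stable letters of an HNN extension of the
    product. The tree edges are not trivial in that extension, so a generator of the fundamental
    group acts as a loop through the tree at a base vertex. *)

Definition subgroup (H : set K) : Prop :=
  [/\ H 1, forall x y, H x -> H y -> H (x * y) & forall x, H x -> H x^-1].

(** For an invariant order on K/H, [P] is the union of the cosets above H. Absorption of H on the
    right makes this a condition on cosets, absorption on the left expresses invariance under the
    stabilizer H. *)
Definition cone (H P : set K) : Prop :=
  [/\ subgroup H,
      forall h g h', H h -> P g -> H h' -> P (h * g * h'),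
      forall x y, P x -> P y -> P (x * y)
    & forall g, exactly_one (P g) (H g) (P g^-1)].

Definition cone_lt (P : set K) (A B : set K) : Prop :=
  exists a b, [/\ A a, B b & P (a^-1 * b)].

Section Subgroup.
Variable H : set K.
Hypothesis sH : subgroup H.

Lemma mem_ltranslate a x : ltranslate a H x <-> H (a^-1 * x).
Proof.
split=> [[h Hh <-]|h]; first by rewrite mulKg.
by exists (a^-1 * x) => //; rewrite mulVKg.
Qed.

Lemma mem_ltranslate_self a : ltranslate a H a.
Proof. by apply/mem_ltranslate; rewrite mulVg; case: sH. Qed.

Lemma eq_ltranslate a b : H (a^-1 * b) -> ltranslate a H = ltranslate b H.
Proof.
case: sH => H1 HM HV hab; apply/seteqP; split=> x /mem_ltranslate hx;
  apply/mem_ltranslate.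
  by have := HM _ _ (HV _ hab) hx; rewrite invgM invgK mulgA mulgK.
by have := HM _ _ hab hx; rewrite mulgA mulgK.
Qed.

Lemma cone_ltE P a b : cone H P ->
  cone_lt P (ltranslate a H) (ltranslate b H) <-> P (a^-1 * b).
Proof.
case=> _ HPH _ _; split=> [[x [y [/mem_ltranslate hx /mem_ltranslate hy Pxy]]]|Pab].
  have -> : a^-1 * b = (a^-1 * x) * (x^-1 * y) * (b^-1 * y)^-1.
    by rewrite invgM invgK !mulgA mulgK mulgK.
  by apply: HPH => //; case: sH => _ _; apply.
by exists a, b; split=> //; exact: mem_ltranslate_self.
Qed.

End Subgroup.

Lemma ltranslateM (k a : K) H : ltranslate k (ltranslate a H) = ltranslate (k * a) H.
Proof.
apply/seteqP; split=> x.
  by case=> y [h Hh <-] <-; exists h => //; rewrite mulgA.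
by case=> h Hh <-; exists (a * h); [exists h | rewrite mulgA].
Qed.

Lemma cone_coset_order H P : cone H P -> coset_order H (cone_lt P).
Proof.
move=> cP; have [sH _ PM Ptri] := cP; split; first split.
- move=> _ _ _ [x _ <-] [y _ <-] [z _ <-].
  move=> /(cone_ltE sH _ _ cP) xy /(cone_ltE sH _ _ cP) yz.
  by apply/(cone_ltE sH _ _ cP); have := PM _ _ xy yz; rewrite mulgA mulgK.
- move=> _ _ [x _ <-] [y _ <-].
  have E1 := cone_ltE sH x y cP; have E2 := cone_ltE sH y x cP.
  have E3 : ltranslate x H = ltranslate y H <-> H (x^-1 * y).
    split=> [E|]; last exact: eq_ltranslate.
    by apply/mem_ltranslate; rewrite E; exact: mem_ltranslate_self.
  have := Ptri (x^-1 * y); rewrite invgM invgK.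
  by case=> -[h1 h2 h3]; [constructor 1|constructor 2|constructor 3]; split;
    by [apply/E1 | apply/E2 | apply/E3 | move/E1 | move/E2 | move/E3].
- move=> k _ _ [x _ <-] [y _ <-] /(cone_ltE sH _ _ cP) xy; rewrite !ltranslateM.
  by apply/(cone_ltE sH _ _ cP); rewrite invgM -mulgA mulKg.
Qed.

(** The union of [P] and [Q] is a positive cone of the group: [P] absorbs H on both sides, so a
    mixed product of elements of [P] and [Q] stays in [P]. *)
Lemma cone_left_order H P (Q : set K) : cone H P ->
  (forall g, Q g -> H g) -> (forall x y, Q x -> Q y -> Q (x * y)) ->
  (forall g, H g -> exactly_one (Q g) (g = 1) (Q g^-1)) ->
  left_order (fun x y => P (x^-1 * y) \/ Q (x^-1 * y)).
Proof.
move=> [[H1 HM HV] HPH PM Ptri] QH QM Qtri.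
have disj g : P g -> ~ H g by move=> Pg Hg; case: (Ptri g) => -[].
split; last by move=> k x y; rewrite invgM -mulgA mulKg.
split=> [x y z _ _ _ xy yz|x y _ _].
  have -> : x^-1 * z = (x^-1 * y) * (y^-1 * z) by rewrite !mulgA mulgK.
  case: xy yz => [p|q] [p'|q']; [left|left|left|right].
  - exact: PM.
  - by rewrite -[_ * _]mul1g mulgA; apply: HPH => //; exact: QH.
  - by rewrite -[_ * _]mulg1; apply: HPH => //; exact: QH.
  - exact: QM.
have {QM HPH PM} -> : (x = y) = (x^-1 * y = 1).
  rewrite propeqE; split=> [->|/mulg1_eq]; first exact: mulVg.
  by rewrite invgK.
have -> : y^-1 * x = (x^-1 * y)^-1 by rewrite invgM invgK.
move: (x^-1 * y) => g.
case: (Ptri g) => -[h1 h2 h3]; [constructor 1|case: (Qtri g h2)|constructor 3].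
- split; [by left | by move=> E; rewrite E in h2|].
  by case=> // /QH/HV; rewrite invgK.
- case=> q1 q2 q3; constructor 1; split=> //; [by right | by case].
- case=> q1 q2 q3; constructor 2; split=> //; by case.
- case=> q1 q2 q3; constructor 3; split=> //; [by case | by right].
split; [by case=> // /QH | by move=> E; rewrite E in h2 | by left].
Qed.

End Cone.

(** * Normal forms of an HNN extension *)

Section NormalForms.
Local Open Scope group_scope.
Local Open Scope classical_set_scope.
Variables (P : groupType) (D : Type) (inv : D -> D).
Variables (A : D -> set P) (th : D -> P -> P).
Hypothesis invK : involutive inv.
Hypothesis A1 : forall d, A d 1.
Hypothesis AM : forall d x y, A d x -> A d y -> A d (x * y).
Hypothesis AV : forall d x, A d x -> A d x^-1.
Hypothesis Ath : forall d x, A d x -> A (inv d) (th d x).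
Hypothesis thK : forall d x, A d x -> th (inv d) (th d x) = x.
Hypothesis thM : forall d x y, A d x -> A d y -> th d (x * y) = th d x * th d y.

(** A representative of the left coset of x modulo [A d]: the predicate given to [xget] depends only
    on the coset, hence so does the chosen value. The trivial coset is represented by 1, so that r =
    1 detects a possible cancellation. *)
Definition transv (d : D) (x : P) : P :=
  if `[< A d x >] then 1 else xget 1 [set y | A d (x^-1 * y)].

Lemma transvP d x : A d (x^-1 * transv d x).
Proof.
rewrite /transv; case: asboolP => [Ax|nAx]; first by rewrite mulg1; exact: AV.
by apply: (@xgetPex _ 1 [set y | A d (x^-1 * y)]); exists x => /=; rewrite mulVg.
Qed.

Lemma transv_coset d x h : A d h -> transv d (x * h) = transv d x.
Proof.
move=> Ah; rewrite /transv.
have -> : A d (x * h) = A d x.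
  rewrite propeqE; split=> [Axh|Ax]; last exact: AM.
  by rewrite -(mulgK h x); apply: AM => //; exact: AV.
case: asboolP => // _; congr xget; rewrite predeqE => y /=; rewrite invgM -mulgA.
split=> Ay; last by apply: AM => //; exact: AV.
by rewrite -(mulVKg h (x^-1 * y)); exact: AM.
Qed.

Lemma transv1 d x : A d x -> transv d x = 1.
Proof. by move=> Ax; rewrite /transv asboolT. Qed.

Lemma transv1P d x : transv d x = 1 -> A d x.
Proof. by move=> E; have := AV (transvP d x); rewrite E mulg1 invgK. Qed.

Lemma transvK d x : transv d (transv d x) = transv d x.
Proof. by rewrite -{1}(mulVKg x (transv d x)) transv_coset //; exact: transvP. Qed.

Lemma transv_quo d x : A d ((transv d x)^-1 * x).
Proof. by have := AV (transvP d x); rewrite invgM invgK. Qed.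

(* [(g, [:: (r_n, d_n); ...; (r_1, d_1)])] stands for the normal form
   [r_1 d_1 ... r_n d_n g]. *)
Definition nform : Type := (P * seq (P * D))%type.

Definition elt_act (g : P) (s : nform) : nform := (s.1 * g, s.2).

(** Right multiplication by d. With g = r a and a in [A d], one has g d = r d (th d a). If r = 1 and
    the last dart is the inverse of d, the two darts cancel and the preceding representative absorbs
    the rest. *)
Definition dart_act (d : D) (s : nform) : nform :=
  let r := transv d s.1 in
  let k := th d (r^-1 * s.1) in
  if s.2 is (r', d') :: l then
    if `[< r = 1 /\ inv d' = d >] then (r' * k, l) else (k, (r, d) :: s.2)
  else (k, [:: (r, d)]).

Fixpoint nform_stack (l : seq (P * D)) : Prop :=
  if l is (r, d) :: l' then
    [/\ transv d r = r,
        if l' is (_, d') :: _ then ~ (r = 1 /\ inv d' = d) else True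
      & nform_stack l']
  else True.

Lemma elt_act1 s : elt_act 1 s = s.
Proof. by case: s => g l; rewrite /elt_act mulg1. Qed.

Lemma elt_actM g h s : elt_act h (elt_act g s) = elt_act (g * h) s.
Proof. by rewrite /elt_act mulgA. Qed.

Lemma dart_act_stack d s : nform_stack s.2 -> nform_stack (dart_act d s).2.
Proof.
case: s => g [|[r' d'] l]; rewrite /dart_act /=; first by rewrite transvK.
case=> rr nr sl; case: asboolP => [_|n] //=; split=> //; exact: transvK.
Qed.

(** After a push the element [k] lies in [A (inv d)], so the inverse dart pops, and [thK] restores
    g. After a pop the representative of [r' * k] is r' again, and the stack condition forbids a
    second cancellation, so the inverse dart pushes back what was removed. *)
Lemma dart_actK d s : nform_stack s.2 -> dart_act (inv d) (dart_act d s) = s.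
Proof.
case: s => g l /= sl; set r := transv d g; set k := th d (r^-1 * g).
have Ak : A (inv d) k by exact: (Ath (transv_quo d g)).
have kE : th (inv d) k = r^-1 * g := thK (transv_quo d g).
have push l' : dart_act (inv d) (k, (r, d) :: l') = (g, l').
  rewrite /dart_act /= transv1 // asboolT // invg1 mul1g kE.
  by rewrite mulVKg.
rewrite [dart_act d _]/dart_act [(g, l).1]/= [(g, l).2]/= -/r -/k.
case: l sl => [|[r' d'] l]; first by move=> _; exact: push.
case=> rr nr sl; case: asboolP => [[r1 dE]|_]; last exact: push.
rewrite /dart_act /=.
have d'E : d' = inv d by rewrite -dE invK.
have -> : transv (inv d) (r' * k) = r' by rewrite transv_coset // -d'E.
rewrite mulKg kE r1 invg1 mul1g -d'E.
case: l nr sl => [|[r2 d2] l] //= nr sl; by case: asboolP.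
Qed.

Lemma dart_act_slide d c s : A d c ->
  dart_act d (elt_act c s) = elt_act (th d c) (dart_act d s).
Proof.
move=> Ac; case: s => g l; rewrite /dart_act /elt_act /= transv_coset //.
set r := transv d g.
have -> : th d (r^-1 * (g * c)) = th d (r^-1 * g) * th d c.
  by rewrite mulgA thM //; exact: transv_quo.
by case: l => [|[r' d'] l] //=; case: asboolP => // _; rewrite mulgA.
Qed.

Fixpoint path_act (l : seq (D * P)) (s : nform) : nform :=
  if l is (d, g) :: l' then path_act l' (elt_act g (dart_act d s)) else s.

Fixpoint no_backtrack (l : seq (D * P)) : Prop :=
  if l is (d, g) :: l' then
    (if l' is (d', _) :: _ then ~ (inv d = d' /\ A d' g) else True)
      /\ no_backtrack l'
  else True.

(* A reduced path only ever pushes, so its normal form has as many darts. *)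
Lemma size_path_act l s : no_backtrack l ->
  (if s.2 is (r, d) :: _ then
     if l is (d', _) :: _ then ~ (inv d = d' /\ A d' s.1) else True
   else True) ->
  size (path_act l s).2 = (size l + size s.2)%N.
Proof.
elim: l s => [|[d g] l IH] s //= [nl rl] h.
have [k [Ak ->]] : exists k, A (inv d) k /\
    dart_act d s = (k, (transv d s.1, d) :: s.2).
  exists (th d ((transv d s.1)^-1 * s.1)); split; first exact/Ath/transv_quo.
  case: s h => g0 [|[r' d'] l'] //= h; rewrite /dart_act /=; case: asboolP => //.
  by case=> r1 dE; case: h; split=> //; exact: transv1P.
rewrite IH //= ?addnS // {IH rl}.
(* The current element is k g with k in [A (inv d)]; if the next dart is [inv d], the factor k does
   not affect membership, so a cancellation would already be a backtrack of the path. *)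
case: l nl => [|[d' g'] l] // nl [dE Akg]; apply: nl; split=> //.
by rewrite -(mulKg k g); apply: AM => //; apply: AV; rewrite -dE.
Qed.

End NormalForms.

(** * Signed turns along reduced paths *)

Section Turns.
Local Open Scope group_scope.
Local Open Scope classical_set_scope.
Variables (P : groupType) (D : Type) (inv : D -> D) (fwd : D -> bool).
Variables (A : D -> set P) (clt : D -> P -> P -> Prop) (dlt : D -> D -> Prop).
Hypothesis invK : involutive inv.
Hypothesis fwd_inv : forall d, fwd (inv d) = ~~ fwd d.
Hypothesis sA : forall d, subgroup (A d).
Hypothesis clt_trans : forall d x y z, clt d x y -> clt d y z -> clt d x z.
Hypothesis clt_tri : forall d x y,
  exactly_one (clt d x y) (A d (x^-1 * y)) (clt d y x).
Hypothesis cltM : forall d k x y, clt d x y -> clt d (k * x) (k * y).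
Hypothesis dlt_trans : forall d1 d2 d3, dlt d1 d2 -> dlt d2 d3 -> dlt d1 d3.
Hypothesis dlt_tri : forall d d', exactly_one (dlt d d') (d = d') (dlt d' d).

(* The pair [(d, g)] stands for the edge [g d] of the Bass-Serre tree issuing
   from the vertex [src d]. *)
Definition link_lt (a b : D * P) : Prop :=
  dlt a.1 b.1 \/ (a.1 = b.1 /\ clt a.1 a.2 b.2).

Definition link_eq (a b : D * P) : Prop := a.1 = b.1 /\ A a.1 (a.2^-1 * b.2).

Lemma link_lt_trans a b c : link_lt a b -> link_lt b c -> link_lt a c.
Proof.
case: a b c => [d x] [d' y] [d'' z]; rewrite /link_lt /= => -[h1|[<- h1]] [h2|[<- h2]].
- by left; exact: dlt_trans h2.
- by left.
- by left.
- by right; split=> //; exact: clt_trans h2.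
Qed.

Lemma link_lt_tri a b : exactly_one (link_lt a b) (link_eq a b) (link_lt b a).
Proof.
case: a b => [d x] [d' y]; rewrite /link_lt /link_eq /=.
have dirr u : ~ dlt u u by move=> h; case: (dlt_tri u u) => -[].
case: (dlt_tri d d') => -[h1 h2 h3].
- constructor 1; split; [by left | by case | by case=> // -[E _]; case: h2].
- subst d'; case: (clt_tri d x y) => -[k1 k2 k3];
    [constructor 1|constructor 2|constructor 3]; split; tauto.
- constructor 3; split; [by case=> // -[] | by case | by left].
Qed.

Lemma link_ltM k d x d' y :
  link_lt (d, x) (d', y) -> link_lt (d, k * x) (d', k * y).
Proof. by case=> /= [h|[<- h]]; [left | right; split=> //; exact: cltM]. Qed.

Definition link_cmp (a b : D * P) : Z :=
  if `[< link_lt a b >] then 1%Z else if `[< link_lt b a >] then (-1)%Z else 0%Z.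

Variant link_cmp_spec a b : Z -> Prop :=
  | LinkLt of link_lt a b & ~ link_eq a b & ~ link_lt b a : link_cmp_spec a b 1%Z
  | LinkEq of ~ link_lt a b & link_eq a b & ~ link_lt b a : link_cmp_spec a b 0%Z
  | LinkGt of ~ link_lt a b & ~ link_eq a b & link_lt b a : link_cmp_spec a b (-1)%Z.

Lemma link_cmpP a b : link_cmp_spec a b (link_cmp a b).
Proof.
rewrite /link_cmp; case: (link_lt_tri a b) => -[h1 h2 h3].
- by rewrite asboolT //; constructor.
- by rewrite !asboolF //; constructor.
- by rewrite asboolF // asboolT //; constructor.
Qed.

Lemma link_cmpN a b : link_cmp b a = (- link_cmp a b)%Z.
Proof.
have E : link_eq a b -> link_eq b a.
  case: a b => [d x] [d' y] [/= <- h]; split=> //=.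
  by case: (sA d) => _ _ AV; have := AV _ h; rewrite invgM invgK.
case: (link_cmpP a b) => h1 h2 h3; case: (link_cmpP b a) => k1 k2 k3 //.
Qed.

(** The sum of three signs is odd, and the values 3 and -3 would each give a cycle of three edges,
    against transitivity. *)
Lemma link_cmp_triple a b c :
  link_cmp a b <> 0%Z -> link_cmp a c <> 0%Z -> link_cmp b c <> 0%Z ->
  (-1 <= link_cmp a b - link_cmp a c + link_cmp b c <= 1)%Z.
Proof.
case: (link_cmpP a b) => // h1 h2 h3; case: (link_cmpP a c) => // k1 k2 k3;
  case: (link_cmpP b c) => // l1 l2 l3 _ _ _ //.
  by case: k1; exact: link_lt_trans l1.
by case: h1; exact: link_lt_trans k1 l3.
Qed.

Definition turn (d : D) (g : P) (d' : D) : Z := link_cmp (d, 1) (d', g).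

(** By invariance the comparison of two edges at a vertex can be translated so that the first one is
    the dart d itself. *)
Lemma link_cmpE d x d' y : link_cmp (d, x) (d', y) = turn d (x^-1 * y) d'.
Proof.
rewrite /turn; have h1 := @link_ltM x^-1 d x d' y; have h2 := @link_ltM x^-1 d' y d x.
rewrite mulVg in h1 h2.
case: (link_cmpP (d, x) (d', y)) => l1 l2 l3;
  case: (link_cmpP (d, 1) (d', x^-1 * y)) => k1 k2 k3 //; first by case: k1; exact: h1.
- by case: k1; exact: h1.
- by case: k2; case: l2 => /= <- ?; split=> //=; rewrite invg1 mul1g.
- by case: k2; case: l2 => /= <- ?; split=> //=; rewrite invg1 mul1g.
- by case: k3; exact: h2.
- by case: k3; exact: h2.
Qed.

Lemma turnV d g d' : turn d' g^-1 d = (- turn d g d')%Z.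
Proof. by rewrite -[g^-1]mulg1 -link_cmpE link_cmpN. Qed.

Lemma turn0P d g d' : turn d g d' = 0%Z <-> d = d' /\ A d g.
Proof.
rewrite /turn; case: link_cmpP => _ h _; split=> //; rewrite /link_eq /= invg1 mul1g in h;
  by [move=> /h | move=> _].
Qed.

(** An element h of [A d] fixes the edge d of the tree, so multiplying by it does not change how the
    other edge compares with d. *)
Lemma turn_slidel d h g d' : A d h -> turn d (h * g) d' = turn d g d'.
Proof.
move=> Ah; have [A1 AM AV] := sA d.
have {1}-> : h * g = (h^-1)^-1 * g by rewrite invgK.
rewrite -link_cmpE /turn.
have lt1 u x : link_lt (d, x) u -> forall y, A d (x^-1 * y) -> link_lt (d, y) u.
  move=> h1 y xy; case: (link_lt_tri (d, y) u) => -[h2 h3 h4] //.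
    case: h3 => /= E yu; case: (link_lt_tri (d, x) u) => -[k1 k2 k3] //; case: k2.
    by split=> //=; have := AM _ _ xy yu; rewrite mulgA mulgK.
  have := link_lt_trans h1 h4; case=> /= [k|[_ k]].
    by case: (dlt_tri d d) => -[].
  by case: (clt_tri d x y) => -[].
have lt2 u x : link_lt u (d, x) -> forall y, A d (x^-1 * y) -> link_lt u (d, y).
  move=> h1 y xy; case: (link_lt_tri u (d, y)) => -[h2 h3 h4] //.
    case: u h1 h3 {h2 h4} => du gu h1 [/= E yu]; subst du.
    case: (link_lt_tri (d, gu) (d, x)) => -[k1 k2 k3] //; case: k2; split=> //=.
    by have := AM _ _ yu (AV _ xy); rewrite invgM invgK -!mulgA mulVKg.
  have := link_lt_trans h4 h1; case=> /= [k|[_ k]].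
    by case: (dlt_tri d d) => -[].
  by case: (clt_tri d y x) => -[] // _ k2 _; case: k2; have := AV _ xy; rewrite invgM invgK.
have Ahg : A d ((h^-1)^-1 * 1) by rewrite invgK mulg1.
have Ahg' : A d (1^-1 * h^-1) by rewrite invg1 mul1g; exact: AV.
case: (link_cmpP (d, h^-1) (d', g)) => l1 l2 l3;
  case: (link_cmpP (d, 1) (d', g)) => k1 k2 k3 //.
- by case: k1; exact: lt1 Ahg.
- by case: k1; exact: lt1 Ahg.
- by case: l1; exact: lt1 Ahg'.
- by case: l3; exact: lt2 Ahg'.
- by case: k3; exact: lt2 Ahg.
- by case: k3; exact: lt2 Ahg.
Qed.

Definition turn_to (d : D) (g : P) (l : seq (D * P)) : Z :=
  if l is (d', _) :: _ then turn d g d' else 0%Z.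

Definition sgn (d : D) : Z := if fwd d then 1%Z else (-1)%Z.

(** At the end of d the path arrives by the edge [inv d] and leaves by the edge g d', whence the
    form of the vertex term. The last group element only moves the end point within its vertex group
    and contributes nothing. *)
Fixpoint Phi (l : seq (D * P)) : Z :=
  if l is (d, g) :: l' then (sgn d + turn_to (inv d) g l' + Phi l')%Z else 0%Z.

Definition proper_turn (d : D) (g : P) (l : seq (D * P)) : Prop :=
  l = [::] \/ turn_to d g l <> 0%Z.

(** This is reducedness: by [turn0P] a zero turn is exactly a backtrack. Stating it through [turn]
    gives the nonzero signs that the estimates use. *)
Fixpoint taut (l : seq (D * P)) : Prop :=
  if l is (d, g) :: l' then proper_turn (inv d) g l' /\ taut l' else True.

Lemma sgn_inv d : sgn (inv d) = (- sgn d)%Z.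
Proof. by rewrite /sgn fwd_inv; case: fwd. Qed.

Lemma turn_pm d g d' : turn d g d' <> 0%Z -> turn d g d' = 1%Z \/ turn d g d' = (-1)%Z.
Proof. by rewrite /turn; case: link_cmpP; tauto. Qed.

Lemma Phi_odd l : taut l -> l = [::] \/ exists k, Phi l = (2 * k + 1)%Z.
Proof.
elim: l => [|[d g] l IH]; first by left.
rewrite [taut _]/= [Phi _]/=; case=> ht /IH {}IH; right.
have [s sE] : exists s, sgn d = (2 * s + 1)%Z.
  by rewrite /sgn; case: fwd; [exists 0%Z | exists (-1)%Z].
case: IH ht => [->|[k kE]]; first by exists s; rewrite sE /=; lia.
case: l kE => [|[d' g'] l] kE.
  by exists s; rewrite sE /=; lia.
case=> // /turn_pm; rewrite /turn_to => -[->|->]; rewrite kE sE.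
  by exists (s + k + 1)%Z; lia.
by exists (s + k)%Z; lia.
Qed.

(** The product of the inverse of l, of x and of lb. Inverting a path moves its last group element
    to the front, where the list format has no place for it; it is returned separately. *)
Fixpoint revcat (l : seq (D * P)) (x : P) (lb : seq (D * P)) : P * seq (D * P) :=
  if l is (d, a) :: l' then revcat l' a^-1 ((inv d, x) :: lb) else (x, lb).

Definition junction (l : seq (D * P)) (x : P) (lb : seq (D * P)) : Z :=
  if l is (d, _) :: _ then turn_to d x lb else 0%Z.

Lemma Phi_revcat l x lb :
  Phi (revcat l x lb).2 = (Phi lb - Phi l + junction l x lb)%Z.
Proof.
elim: l x lb => [|[d a] l IH] x lb /=; first by lia.
rewrite IH /= sgn_inv invK.
have -> : junction l a^-1 ((inv d, x) :: lb) = (- turn_to (inv d) a l)%Z.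
  by case: l {IH} => [|[d' a'] l] //=; exact: turnV.
lia.
Qed.

Lemma taut_revcat l x lb : taut l -> taut lb ->
  (l = [::] \/ lb = [::] \/ junction l x lb <> 0%Z) -> taut (revcat l x lb).2.
Proof.
elim: l x lb => [|[d a] l IH] x lb //= [hp tl] tlb hj.
apply: IH => //=; first by rewrite invK; split=> //; case: hj.
case: hp => [|hp]; [by left | right; right].
case: l hp {tl hj} => [|[d' a'] l] //= hp h; apply: hp.
by rewrite turnV in h; lia.
Qed.

(** * Values of reduced paths in a group, and the resulting cones *)

Section Evaluation.
Variables (G : groupType) (V : Type) (src : D -> V).
Variables (cls : V -> P -> G) (t : D -> G) (th : D -> P -> P).
Hypothesis clsM : forall v x y, cls v (x * y) = cls v x * cls v y.
Hypothesis t_inv : forall d, t (inv d) = (t d)^-1.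
Hypothesis A_th : forall d x, A d x -> A (inv d) (th d x).
Hypothesis cls_t : forall d x, A d x ->
  cls (src d) x * t d = t d * cls (src (inv d)) (th d x).

Lemma cls1 v : cls v 1 = 1.
Proof. by apply: (@mulgI _ (cls v 1)); rewrite -clsM !mulg1. Qed.

Lemma clsV v x : cls v x^-1 = (cls v x)^-1.
Proof. by apply: (@mulgI _ (cls v x)); rewrite -clsM !mulgV cls1. Qed.

Fixpoint gallery (v : V) (l : seq (D * P)) (w : V) : Prop :=
  if l is (d, _) :: l' then src d = v /\ gallery (src (inv d)) l' w else v = w.

Fixpoint eval (l : seq (D * P)) : G :=
  if l is (d, g) :: l' then t d * cls (src (inv d)) g * eval l' else 1.

Lemma gallery_revcat l x lb m v w :
  gallery m l v -> gallery m lb w -> gallery v (revcat l x lb).2 w.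
Proof.
elim: l x lb m => [|[d a] l IH] x lb m /=; first by move->.
by case=> dm gl glb; apply: (IH _ _ (src (inv d))) => //=; rewrite invK dm.
Qed.

Lemma eval_revcat l x lb m v : gallery m l v ->
  cls v (revcat l x lb).1 * eval (revcat l x lb).2
  = (eval l)^-1 * cls m x * eval lb.
Proof.
elim: l x lb m => [|[d a] l IH] x lb m /=; first by move=> ->; rewrite invg1 mul1g.
case=> dm gl; rewrite (IH _ _ _ gl) /= invK dm t_inv clsV !invgM !mulgA.
by [].
Qed.

Definition tpath (v w : V) (x : G) (l : seq (D * P)) : Prop :=
  [/\ gallery v l w, taut l & exists g, x = cls v g * eval l].

(* Two reduced paths from the vertex [m] are stripped of their common initial part;
   the dart [d] records where they came from, so that the last clause is preserved
   by the recursion. *)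
Lemma tpath_join m v w la lb a b :
  gallery m la v -> taut la -> gallery m lb w -> taut lb ->
  exists r, tpath v w ((cls m a * eval la)^-1 * (cls m b * eval lb)) r /\
  (-1 <= Phi r - Phi lb + Phi la <= 1)%Z /\
  forall d, proper_turn d a la -> proper_turn d b lb ->
    (-1 <= Phi r - (turn_to d b lb + Phi lb) + (turn_to d a la + Phi la) <= 1)%Z.
Proof.
elim: la lb m a b => [|[da a1] la IH] [|[db b1] lb] m a b ga ta gb tb.
- exists [::]; split; last by split=> //= d; lia.
  rewrite /= in ga gb; subst v w; split=> //=; exists (a^-1 * b).
  by rewrite !mulg1 clsM clsV.
- exists ((db, b1) :: lb); split; last first.
    split; first by rewrite /=; lia.
    move=> d _ [//|hb]; rewrite [turn_to d a _]/=; rewrite [turn_to d b _]/= in hb *.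
    by case: (turn_pm hb) => ->; rewrite [Phi [::]]/=; lia.
  move: ga => /= mv; subst v; split=> //; exists (a^-1 * b).
  by rewrite clsM clsV mulg1 !mulgA.
- set la0 := (da, a1) :: la in ga ta *.
  exists (revcat la0 (a^-1 * b) [::]).2; split; last first.
    rewrite Phi_revcat; split; first by rewrite /=; lia.
    move=> d [//|ha] _; rewrite [turn_to d b _]/=; rewrite [turn_to d a _]/= in ha *.
    by case: (turn_pm ha) => ->; rewrite [junction _ _ _]/= [Phi [::]]/=; lia.
  split; [exact: gallery_revcat ga gb | by apply: taut_revcat => //; right; left |].
  exists (revcat la0 (a^-1 * b) [::]).1.
  by rewrite (eval_revcat _ _ ga) /= !mulg1 clsM clsV invgM !mulgA.
(* A nonzero turn means that the paths separate here: the reversed first path and the second one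
   join without cancellation, and the edge d they came from is the third leg of a tripod. Otherwise
   the first edges coincide and are stripped. *)
have [t0|tn0] := pselect (turn da (a^-1 * b) db = 0%Z); last first.
  set la0 := (da, a1) :: la in ga ta *; set lb0 := (db, b1) :: lb in gb tb *.
  have jE : junction la0 (a^-1 * b) lb0 = turn da (a^-1 * b) db by [].
  exists (revcat la0 (a^-1 * b) lb0).2; split; last first.
    rewrite Phi_revcat jE; split; first by case: (turn_pm tn0) => ->; lia.
    move=> d [//|ha] [//|hb]; rewrite /turn_to /= in ha hb *.
    have := @link_cmp_triple (d, 1) (da, a) (db, b).
    by rewrite link_cmpE => /(_ ha hb tn0); rewrite /turn; lia.
  split; [exact: gallery_revcat ga gb | |].
    by apply: taut_revcat => //; right; right; rewrite jE.
  exists (revcat la0 (a^-1 * b) lb0).1.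
  by rewrite (eval_revcat _ _ ga) clsM clsV invgM !mulgA.
case/turn0P: t0 => dE Ah; subst db; set h := a^-1 * b in Ah.
case: ga => dm ga; case: ta => pa ta; case: gb => _ gb; case: tb => pb tb.
have Ath := A_th Ah.
have slide l : turn_to (inv da) (th da h * b1) l = turn_to (inv da) b1 l.
  by case: l => [|[d' b'] l] //=; exact: turn_slidel.
have [r [[gr tr [g rE]] [_ hr]]] := IH lb _ a1 (th da h * b1) ga ta gb tb.
(* The stripped edge plays the role of the incoming edge one vertex further; its sign occurs in both
   paths and cancels. *)
have {}hr : (-1 <= Phi r - Phi ((da, b1) :: lb) + Phi ((da, a1) :: la) <= 1)%Z.
  have := hr (inv da) pa; rewrite /proper_turn slide => /(_ pb) /=; lia.
exists r; split; last first.
  (* Since b = a h with h in [A da], both paths start with the same edge, which makes the same turn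
     with d. *)
  split=> // d _ _; suff -> : turn_to d a ((da, a1) :: la) = turn_to d b ((da, b1) :: lb).
    by lia.
  have bE : b = a * h by rewrite mulVKg.
  rewrite /= -[RHS]Z.opp_involutive -turnV bE invgM turn_slidel ?turnV ?Z.opp_involutive //.
  by case: (sA da) => _ _; apply.
split=> //; exists g; rewrite -rE /= !invgM !clsM !mulgA; congr (_ * _ * _).
rewrite -!mulgA; congr (_ * (_ * _)).
have := cls_t Ah; rewrite dm clsM clsV => hE.
by rewrite (mulgA _ (cls m b)) hE mulKg.
Qed.

Lemma tpath_inv v w x l : tpath v w x l ->
  exists2 l', tpath w v x^-1 l' & Phi l' = (- Phi l)%Z.
Proof.
case=> gl tl [g ->]; exists (revcat l g^-1 [::]).2; last first.
  by rewrite Phi_revcat; case: l {gl tl} => [|[d a] l]; rewrite /=; lia.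
split; [exact: gallery_revcat gl _ | by apply: taut_revcat => //; right; left |].
exists (revcat l g^-1 [::]).1.
by rewrite (eval_revcat _ _ gl) /= mulg1 clsV invgM.
Qed.

(** The two paths are joined at w after reversing the first. Two positive integers add up to at
    least 2, which outweighs the error 1. *)
Lemma tpath_mul v w u x y l l' : tpath v w x l -> tpath w u y l' ->
  exists2 r, tpath v u (x * y) r & (Phi l > 0 -> Phi l' > 0 -> Phi r > 0)%Z.
Proof.
move=> /tpath_inv [a [ga ta [g xE]] aE] [gl tl [h ->]].
have [r [tr [hr _]]] := @tpath_join w v u a l' g h ga ta gl tl.
exists r; first by move: tr; rewrite -xE invgK.
lia.
Qed.

Lemma tpath_cls v g : tpath v v (cls v g) [::].
Proof. by split=> //; exists g; rewrite mulg1. Qed.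

Lemma tpath_dart d : tpath (src d) (src (inv d)) (t d) [:: (d, 1)].
Proof. by split=> //=; [split=> //; left | exists 1; rewrite !cls1 !mulg1 mul1g]. Qed.

Lemma tpath_clsl v w x l g : tpath v w x l -> tpath v w (cls v g * x) l.
Proof. by case=> gl tl [h ->]; split=> //; exists (g * h); rewrite clsM mulgA. Qed.

Lemma tpath_clsr v w x l g : tpath v w x l ->
  exists2 l', tpath v w (x * cls w g) l' & Phi l' = Phi l.
Proof.
move=> /tpath_inv [a ta aE]; have /tpath_inv [r tr rE] := tpath_clsl g^-1 ta.
exists r; last by lia.
by move: tr; rewrite invgM invgK clsV invgK.
Qed.

Definition positive_elts (v : V) : set G := [set x | exists2 l, tpath v v x l & (Phi l > 0)%Z].

(** If x and its inverse both had paths with positive [Phi], their product would be a path of value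
    1 with positive [Phi], whereas such a path is empty. A zero [Phi] is even, so its path is empty
    and x lies in the vertex group. *)
Lemma positive_cone v : (forall x, exists l, tpath v v x l) ->
  (forall l, tpath v v 1 l -> l = [::]) -> cone (range (cls v)) (positive_elts v).
Proof.
move=> tpath_ex tpath1; split.
- split; first by exists 1 => //; rewrite cls1.
  + by move=> _ _ [x _ <-] [y _ <-]; exists (x * y) => //; rewrite clsM.
  + by move=> _ [x _ <-]; exists (x^-1) => //; rewrite clsV.
- move=> _ x _ [g _ <-] [l tl lP] [h _ <-].
  have [l' tl' lE] := tpath_clsr h (tpath_clsl g tl).
  by exists l'; rewrite ?lE.
- move=> x y [l tl lP] [l' tl' lP'].
  by have [r tr rP] := tpath_mul tl tl'; exists r => //; exact: rP.
- have clsP x l : range (cls v) x -> tpath v v x l -> l = [::].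
    by move=> [g _ <-] /(tpath_clsl g^-1); rewrite clsV mulVg => /tpath1.
  have posH x : positive_elts v x -> ~ range (cls v) x.
    by case=> l tl lP /clsP-/(_ _ tl) lE; rewrite lE in lP.
  have posV x : positive_elts v x -> ~ positive_elts v x^-1.
    move=> [l tl lP] [l' tl' lP'].
    by have [r] := tpath_mul tl tl'; rewrite mulgV => /tpath1 -> /(_ lP lP').
  move=> x; have [l tl] := tpath_ex x.
  have [l0|[lP|lN]] : (Phi l = 0 \/ Phi l > 0 \/ Phi l < 0)%Z by lia.
  + have xH : range (cls v) x.
      case: (tl) => _ tautl [g xE]; have [lE|[k kE]] := Phi_odd tautl; last by lia.
      by exists g => //; rewrite xE lE mulg1.
    constructor 2; split=> //; first by move/posH.
    by move/posH; apply; case: xH => g _ <-; exists (g^-1) => //; rewrite clsV.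
  + have xP : positive_elts v x by exists l.
    by constructor 1; split; [|exact: posH|exact: posV].
  + have [l' tl' lE] := tpath_inv tl.
    have xP : positive_elts v x^-1 by exists l' => //; lia.
    constructor 3; split=> //.
      by move/posV; exact.
    by move=> [g _ xE]; apply: (posH _ xP); exists (g^-1) => //; rewrite clsV xE.
Qed.

Lemma positive_eltsE v x l : cone (range (cls v)) (positive_elts v) -> tpath v v x l ->
  positive_elts v x <-> (Phi l > 0)%Z.
Proof.
move=> [_ _ _ tri] tl; split=> [xP|lP]; last by exists l.
have [//|lN] : (Phi l > 0 \/ Phi l <= 0)%Z by lia.
case: (tri x) => -[h1 h2 h3] //; case: h2.
have [l0|l0] : (Phi l = 0 \/ Phi l < 0)%Z by lia.
  case: tl => _ tautl [g ->]; case: (Phi_odd tautl) => [->|[k kE]]; last by lia.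
  by exists g => //; rewrite mulg1.
by case: h3; have [l' tl' lE] := tpath_inv tl; exists l' => //; lia.
Qed.

End Evaluation.
End Turns.

(** * Walks and spanning trees *)

Section Walks.
Local Open Scope classical_set_scope.
Variable Gam : graph.
Implicit Types (E : set (edge Gam)) (v w : vertex Gam) (p : seq (dart Gam)).

Definition dinv (d : dart Gam) : dart Gam := (d.1, ~~ d.2).

Lemma dinvK : involutive dinv.
Proof. by case=> e b; rewrite /dinv /= negbK. Qed.

Lemma src_dinv d : dart_src (dinv d) = dart_tgt d.
Proof. by case: d => e []. Qed.

Lemma walk_cat E v p q w :
  walk E v (p ++ q) w <-> exists u, walk E v p u /\ walk E u q w.
Proof.
elim: p v => [|d p IH] v /=; first by split=> [h|[u [<-]] //]; exists v.
split=> [[Ed dv /IH[u [h1 h2]]]|[u [[Ed dv h1] h2]]]; first by exists u.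
by split=> //; apply/IH; exists u.
Qed.

Lemma walk_sub E E' v p w : E `<=` E' -> walk E v p w -> walk E' v p w.
Proof. by move=> sE; elim: p v => //= d p IH v [/sE Ed dv /IH]. Qed.

Lemma reduced_cons d p : reduced (d :: p) -> reduced p.
Proof. by move=> rp p1 p2 e b pE; apply: (rp (d :: p1) p2 e b); rewrite pE. Qed.

Lemma reduced_rcons p d : reduced (rcons p d) -> reduced p.
Proof.
move=> rp p1 p2 e b pE; apply: (rp p1 (rcons p2 d) e b).
by rewrite pE rcons_cat.
Qed.

Lemma not_reduced p : ~ reduced p ->
  exists p1 p2 e b, p = p1 ++ (e, b) :: (e, ~~ b) :: p2.
Proof.
move=> nr; apply: contrapT => h; apply: nr => p1 p2 e b pE.
by apply: h; exists p1, p2, e, b.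
Qed.

Lemma subtree_walk V0 E0 v p w :
  @subtree Gam V0 E0 -> V0 v -> walk E0 v p w -> V0 w.
Proof.
move=> sT; elim: p v => [|d p IH] v Vv /=; first by move<-.
case=> /(subtree_ends sT)[Vi Vt] _; apply: IH.
by rewrite /dart_tgt; case: d.2.
Qed.

(** * Attaching a pendant edge to a subtree *)

Section PendantEdge.
Variables (V0 : set (vertex Gam)) (E0 : set (edge Gam)) (d0 : dart Gam).
Hypothesis sT : subtree V0 E0.
Let a := dart_src d0.
Let b := dart_tgt d0.
Hypothesis Va : V0 a.
Hypothesis Vb : ~ V0 b.

Let E1 := E0 `|` [set d0.1].

Lemma pendant_dart d : E1 d.1 -> E0 d.1 \/ d = d0 \/ d = dinv d0.
Proof.
case=> [|dE]; [by left | right].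
case: d d0 dE => [e c] [e' c'] /= ->; rewrite /dinv /=.
by case: c c' => -[]; tauto.
Qed.

(** The new vertex b is entered only by [d0] and left only by [dinv d0], so a reduced walk that
    reaches b must stop there. *)
Lemma pendant_walk x p y : V0 x -> reduced p -> walk E1 x p y ->
  walk E0 x p y \/ exists2 q, p = rcons q d0 & y = b /\ walk E0 x q a.
Proof.
elim: p x => [|d p IH] x Vx rp /=; first by left.
case=> Ed dx pw; case: (pendant_dart Ed) => [E0d|[dE|dE]].
- have [Vi Vt] := subtree_ends sT E0d.
  have Vd : V0 (dart_tgt d) by rewrite /dart_tgt; case: d.2.
  case: (IH _ Vd (reduced_cons rp) pw) => [h|[q -> [yb qw]]]; first by left.
  by right; exists (d :: q).
- subst d; right; case: p rp pw {IH} => [|d p] rp.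
    by move=> /= <-; exists [::] => //=; split.
  case=> Ed' db _; case: (pendant_dart Ed') => [E0d|[dE|dE]].
  + have [Vi Vt] := subtree_ends sT E0d; case: Vb.
    by rewrite /b -db /dart_src; case: d.2.
  + by subst d; case: Vb; rewrite /b -db.
  + case: (rp [::] p d0.1 d0.2); rewrite dE /dinv; by case: (d0).
- by case: Vb; rewrite /b -src_dinv -dE dx.
Qed.

(** For acyclicity, a nonempty reduced closed walk at the new vertex leaves by [dinv d0] and returns
    by [d0]; in between it is a reduced closed walk of the old tree, hence empty, and the walk
    backtracks. *)
Lemma pendant_subtree : subtree (V0 `|` [set b]) E1.
Proof.
have conn : forall v, V0 v -> exists p, walk E1 v p b.
  move=> v Vv; have [p pw] := subtree_connected sT Vv Va.
  exists (rcons p d0); rewrite -cats1; apply/walk_cat; exists a; split.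
    by apply: walk_sub pw; exact: subsetUl.
  by split=> //; right.
have conn' : forall v, V0 v -> exists p, walk E1 b p v.
  move=> v Vv; have [p pw] := subtree_connected sT Va Vv.
  exists (dinv d0 :: p); split; [by right | exact: src_dinv |].
  rewrite -src_dinv dinvK; apply: walk_sub pw; exact: subsetUl.
split.
- move=> e [/(subtree_ends sT)[Vi Vt]|->]; first by split; left.
  move: Va Vb; rewrite /a /b /dart_src /dart_tgt.
  by case: d0.2 => h _; split; by [left | right].
- by case: (subtree_nonempty sT) => v Vv; exists v; left.
- move=> v w [Vv|->] [Vw|->].
  + have [p pw] := subtree_connected sT Vv Vw; exists p.
    by apply: walk_sub pw; exact: subsetUl.
  + exact: conn.
  + exact: conn'.
  + by exists [::].
- move=> v p pw rp; have [Vv|nVv] := pselect (V0 v).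
    case: (pendant_walk Vv rp pw) => [h|[q _ [vb _]]].
      exact: (subtree_acyclic sT) h rp.
    by case: Vb; rewrite -vb.
  case: p pw rp => // d p [/pendant_dart Ed dv pw] rp.
  have dE : d = dinv d0.
    case: Ed => [E0d|[dE|//]]; case: nVv; last by rewrite -dv dE.
    have [Vi Vt] := subtree_ends sT E0d; by rewrite -dv /dart_src; case: d.2.
  have ta : dart_tgt d = a by rewrite -src_dinv dE dinvK.
  have Vt : V0 (dart_tgt d) by rewrite ta.
  case: (pendant_walk Vt (reduced_cons rp) pw) => [h|[q pE [vb qw]]].
    by case: nVv; exact: (subtree_walk sT Vt h).
  subst p; rewrite ta in qw.
  have q0 : q = [::].
    by apply: (subtree_acyclic sT) qw _; exact: reduced_rcons (reduced_cons rp).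
  case: (rp [::] [::] d0.1 (~~ d0.2)); rewrite q0 dE /dinv /= negbK; by case: (d0).
Qed.

End PendantEdge.

(** A walk from the subtree to a missing vertex crosses a dart leaving the subtree, and attaching
    that dart contradicts maximality. *)
Lemma maximal_subtree_spanning V0 E0 : connected_graph Gam ->
  maximal_subtree V0 E0 -> forall v, V0 v.
Proof.
move=> [_ conn] [sT maxT] v; apply: contrapT => nVv.
have [u Vu] := subtree_nonempty sT; have [p pw] := conn u v.
have [d [Vd nVd]] : exists d, V0 (dart_src d) /\ ~ V0 (dart_tgt d).
  elim: p u Vu pw => [|d p IH] u Vu /=; first by move=> uv; rewrite uv in Vu.
  case=> _ du pw; have [Vt|nVt] := pselect (V0 (dart_tgt d)); first exact: IH pw.
  by exists d; rewrite du.
have [] := maxT _ _ (pendant_subtree sT Vd nVd); [by left|by left|] => sV _.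
by apply: nVd; apply: sV; right.
Qed.

End Walks.

(* All vertex groups are embedded in their product, so that elements of different
   vertex groups can be multiplied without transporting along vertex equalities. *)
Definition vprod Gam (GG : graph_of_groups Gam) : Type := forall v, vgrp GG v.

Section VertexProduct.
Local Open Scope group_scope.
Variables (Gam : graph) (GG : graph_of_groups Gam).

HB.instance Definition _ := Choice.copy (vprod GG) {classic (vprod GG)}.

Definition vprod_mul (x y : vprod GG) : vprod GG := fun v => x v * y v.
Definition vprod_one : vprod GG := fun v => 1.
Definition vprod_inv (x : vprod GG) : vprod GG := fun v => (x v)^-1.

Lemma vprodP (x y : vprod GG) : (forall v, x v = y v) -> x = y.
Proof. exact: functional_extensionality_dep. Qed.

Lemma vprod_mulA : associative vprod_mul.
Proof. by move=> x y z; apply: vprodP => v; exact: mulgA. Qed.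
Lemma vprod_mul1 : left_id vprod_one vprod_mul.
Proof. by move=> x; apply: vprodP => v; exact: mul1g. Qed.
Lemma vprod_mulr1 : right_id vprod_one vprod_mul.
Proof. by move=> x; apply: vprodP => v; exact: mulg1. Qed.
Lemma vprod_mulV : left_inverse vprod_one vprod_inv vprod_mul.
Proof. by move=> x; apply: vprodP => v; exact: mulVg. Qed.
Lemma vprod_mulrV : right_inverse vprod_one vprod_inv vprod_mul.
Proof. by move=> x; apply: vprodP => v; exact: mulgV. Qed.

HB.instance Definition _ := isGroup.Build (vprod GG)
  vprod_mulA vprod_mul1 vprod_mulr1 vprod_mulV vprod_mulrV.

Definition single v (g : vgrp GG v) : vprod GG := fun w =>
  if pselect (v = w) is left E then ecast x (vgrp GG x) E g else 1.

Lemma single_same v (g : vgrp GG v) : single g v = g.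
Proof.
rewrite /single; case: pselect => // E.
by rewrite (Prop_irrelevance E (erefl v)).
Qed.

Lemma singleM v (g h : vgrp GG v) : single (g * h) = single g * single h.
Proof.
apply: vprodP => w; rewrite /single /mul /= /vprod_mul; case: pselect => [E|_].
  by case: w / E.
by rewrite mulg1.
Qed.

Lemma single1 v : single (1 : vgrp GG v) = 1.
Proof. by apply: (@mulgI _ (single (1 : vgrp GG v))); rewrite -singleM !mulg1. Qed.

Lemma singleV v (g : vgrp GG v) : single g^-1 = (single g)^-1.
Proof. by apply: (@mulgI _ (single g)); rewrite -singleM !mulgV single1. Qed.

End VertexProduct.

(** * The fundamental group *)

Section CosetOrders.
Local Open Scope group_scope.
Local Open Scope classical_set_scope.
Variables (K : groupType) (H : set K) (lt : set K -> set K -> Prop).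
Hypothesis sH : subgroup H.
Hypothesis oH : coset_order H lt.
Let clt x y := lt (ltranslate x H) (ltranslate y H).

Let left_cosetsI x : left_cosets H (ltranslate x H). Proof. by exists x. Qed.

Lemma coset_order_trans x y z : clt x y -> clt y z -> clt x z.
Proof. by case: oH => -[tr _] _; apply: tr. Qed.

Lemma coset_order_tri x y : exactly_one (clt x y) (H (x^-1 * y)) (clt y x).
Proof.
case: oH => -[_ tri] _.
have := tri _ _ (left_cosetsI x) (left_cosetsI y).
suff -> : (ltranslate x H = ltranslate y H) = H (x^-1 * y) by [].
rewrite propeqE; split=> [E|]; last exact: eq_ltranslate.
by apply/mem_ltranslate; rewrite E; exact: mem_ltranslate_self.
Qed.

Lemma coset_orderM k x y : clt x y -> clt (k * x) (k * y).
Proof.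
by case: oH => _ inva xy; rewrite /clt -!ltranslateM; apply: inva.
Qed.

End CosetOrders.

Section BassSerre.
Local Open Scope group_scope.
Local Open Scope classical_set_scope.
Variables (Gam : graph) (GG : graph_of_groups Gam) (E0 : set (edge Gam)).

Local Notation P := (vprod GG).
Local Notation D := (dart Gam).
Local Notation inv := (@dinv Gam).
Local Notation src := (@dart_src Gam).
Local Notation G := (fundamental_group GG E0).

Definition dmap (d : D) : egrp GG d.1 -> vgrp GG (src d) :=
  match d return egrp GG d.1 -> vgrp GG (src d) with
  | (e, true) => init_map GG e
  | (e, false) => term_map GG e
  end.

Arguments dmap : clear implicits.

Lemma dmapM d x y : dmap d (x * y) = dmap d x * dmap d y.
Proof. by case: d x y => e [] x y; exact: gmulfM. Qed.

Lemma dmap1 d : dmap d 1 = 1.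
Proof. by case: d => e []; exact: gmulf1. Qed.

Lemma dmapV d x : dmap d x^-1 = (dmap d x)^-1.
Proof. by case: d x => e [] x; exact: gmulfV. Qed.

Lemma dmap_inj d : injective (dmap d).
Proof. by case: d => e []; [exact: init_map_inj | exact: term_map_inj]. Qed.

Lemma range_dmap_subgroup d : subgroup (range (dmap d)).
Proof.
split; first by exists 1 => //; exact: dmap1.
  by move=> _ _ [x _ <-] [y _ <-]; exists (x * y) => //; exact: dmapM.
by move=> _ [x _ <-]; exists (x^-1) => //; exact: dmapV.
Qed.

(* The cylinder over the edge subgroup: unlike [strict_esub] below, it is relatively
   convex in the whole product. *)
Definition esub (d : D) : set P := fun x => range (dmap d) (x (src d)).

Lemma esub_subgroup d : subgroup (esub d).
Proof.
case: (range_dmap_subgroup d) => h1 hM hV; rewrite /esub; split=> [|x y hx hy|x hx].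
- exact: h1.
- exact: hM.
- exact: hV.
Qed.

Definition dpre (d : D) (x : P) : egrp GG d.1 :=
  xget 1 [set c | dmap d c = x (src d)].

(** Conjugation by the stable letter, read in the product: the edge-group element is carried to the
    other end of d, and all other coordinates become 1. *)
Definition dtrans (d : D) (x : P) : P := single (dmap (inv d) (dpre d x)).

Lemma dpreE d c (x : P) : x (src d) = dmap d c -> dpre d x = c.
Proof.
move=> xE; apply: (@dmap_inj d); rewrite -xE.
by apply: (@xgetPex _ 1 [set c | dmap d c = x (src d)]); exists c.
Qed.

Lemma dtransE d c (x : P) : x (src d) = dmap d c -> dtrans d x = single (dmap (inv d) c).
Proof. by rewrite /dtrans => /dpreE ->. Qed.

Lemma esub_dtrans d x : esub d x -> esub (inv d) (dtrans d x).
Proof. by case=> c _ /esym/dtransE ->; exists c => //; rewrite single_same. Qed.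

Definition cls (v : vertex Gam) (x : P) : G := word_class E0 [:: Elt (x v)].
Definition tcls (d : D) : G := word_class E0 [:: Stab d.1 d.2].

Lemma word_class_cat u w : word_class E0 (u ++ w) = word_class E0 u * word_class E0 w :> G.
Proof. by rewrite [RHS]fg_mulE. Qed.

Lemma clsM v x y : cls v (x * y) = cls v x * cls v y.
Proof.
by rewrite /cls -word_class_cat; apply/word_classP/word_sym; exact: word_mul.
Qed.

Lemma tcls_inv d : tcls (inv d) = (tcls d)^-1.
Proof. by rewrite [RHS]fg_invE. Qed.

Lemma cls_tcls d x : esub d x ->
  cls (src d) x * tcls d = tcls d * cls (src (inv d)) (dtrans d x).
Proof.
have conj e (c : egrp GG e) : (tcls (e, true))^-1 * word_class E0 [:: Elt (init_map GG e c)]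
    * tcls (e, true) = word_class E0 [:: Elt (term_map GG e c)].
  rewrite -tcls_inv /tcls -(word_class_cat [:: _] [:: _]) -word_class_cat.
  by apply/word_classP; exact: word_conj.
case=> c _ /esym xE; rewrite (dtransE xE) /cls single_same xE.
have hl (a y z : G) : a^-1 * y * a = z -> y * a = a * z.
  by move=> <-; rewrite !mulgA mulgV mul1g.
have hr (a y z : G) : a^-1 * y * a = z -> z * a^-1 = a^-1 * y.
  by move=> <-; rewrite mulgK.
case: d c x xE => e [] c x xE; first by apply: hl; exact: conj.
rewrite -[(e, false)]/(inv (e, true)) tcls_inv; apply: hr; exact: conj.
Qed.

Lemma tcls_tree d : E0 d.1 -> tcls d = 1.
Proof.
move=> Ed; have h : tcls (d.1, true) = 1.
  by apply/word_classP; exact: word_tree.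
case: d Ed h => e [] //= _ h.
by rewrite -[(e, false)]/(inv (e, true)) tcls_inv h invg1.
Qed.

Section Orders.
Variables (lti : forall e, set (vgrp GG (init e)) -> set (vgrp GG (init e)) -> Prop)
  (ltt : forall e, set (vgrp GG (term e)) -> set (vgrp GG (term e)) -> Prop)
  (dlt : D -> D -> Prop).
Hypothesis lti_order : forall e, coset_order (range (init_map GG e)) (@lti e).
Hypothesis ltt_order : forall e, coset_order (range (term_map GG e)) (@ltt e).
Hypothesis dlt_trans : forall d1 d2 d3, dlt d1 d2 -> dlt d2 d3 -> dlt d1 d3.
Hypothesis dlt_tri : forall d d', exactly_one (dlt d d') (d = d') (dlt d' d).

Definition dord (d : D) : set (vgrp GG (src d)) -> set (vgrp GG (src d)) -> Prop :=
  match d return set (vgrp GG (src d)) -> set (vgrp GG (src d)) -> Prop with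
  | (e, true) => @lti e
  | (e, false) => @ltt e
  end.

Arguments dord : clear implicits.

Lemma dord_order d : coset_order (range (dmap d)) (dord d).
Proof. by case: d => e []; [exact: lti_order | exact: ltt_order]. Qed.

Definition elt_lt (d : D) (x y : P) : Prop :=
  dord d (ltranslate (x (src d)) (range (dmap d))) (ltranslate (y (src d)) (range (dmap d))).

Lemma elt_lt_trans d x y z : elt_lt d x y -> elt_lt d y z -> elt_lt d x z.
Proof. exact: (coset_order_trans (dord_order d)). Qed.

Lemma elt_lt_tri d x y : exactly_one (elt_lt d x y) (esub d (x^-1 * y)) (elt_lt d y x).
Proof. exact: (coset_order_tri (range_dmap_subgroup d) (dord_order d)). Qed.

Lemma elt_ltM d k x y : elt_lt d x y -> elt_lt d (k * x) (k * y).
Proof. exact: (coset_orderM (dord_order d)). Qed.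

Definition dfwd (d : D) : bool := d.2.

Lemma dfwd_inv d : dfwd (inv d) = ~~ dfwd d. Proof. by []. Qed.

Local Notation tpath := (tpath inv elt_lt dlt src cls tcls).
Local Notation Phi := (Phi inv dfwd elt_lt dlt).
Local Notation taut := (taut inv elt_lt dlt).
Local Notation gallery := (gallery inv src).
Local Notation eval := (eval inv src cls tcls).
Local Notation turn := (turn elt_lt dlt).

Let tpath_mul := tpath_mul (@dinvK Gam) dfwd_inv esub_subgroup elt_lt_trans elt_lt_tri
  elt_ltM dlt_trans dlt_tri clsM tcls_inv esub_dtrans cls_tcls.

Lemma tpath_mul_ex v w u x y : (exists l, tpath v w x l) -> (exists l, tpath w u y l) ->
  exists l, tpath v u (x * y) l.
Proof. by case=> l hl [l' hl']; have [r hr _] := tpath_mul hl hl'; exists r. Qed.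

Lemma tpath_walk v p w : walk E0 v p w -> exists l, tpath v w 1 l.
Proof.
elim: p v => [|d p IH] v /=.
  by move=> <-; exists [::]; split=> //; exists 1; rewrite (cls1 clsM) mulg1.
case=> Ed <- /IH pl; rewrite -[1]mulg1; apply: tpath_mul_ex pl.
rewrite -(tcls_tree Ed) -src_dinv; exists [:: (d, 1)].
exact: tpath_dart clsM d.
Qed.

Hypothesis E0_connected : forall v w, exists p, walk E0 v p w.

(** Each letter of a word is a path between its end vertices; tree walks, which have value 1,
    connect it to the base vertex on both sides. *)
Lemma tpath_ex v x : exists l, tpath v v x l.
Proof.
have tree u w : exists l, tpath u w 1 l.
  by have [p /tpath_walk] := E0_connected u w.
rewrite -(word_reprK x); elim: (word_repr x) => [|a w IH].
  exact: (tree v v).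
rewrite -cat1s word_class_cat; apply: tpath_mul_ex IH.
rewrite -[word_class _ _]mulg1 -[word_class _ _]mul1g.
case: a => [u g|e b]; [set z := u|set z := src (e, b)];
  [set z' := u|set z' := src (inv (e, b))]; apply: tpath_mul_ex (tree z' v);
  apply: (tpath_mul_ex (tree v z)).
  by exists [::]; have := tpath_cls inv elt_lt dlt src cls tcls u (single g);
    rewrite /cls single_same.
by exists [:: ((e, b), 1)]; exact: (@tpath_dart _ _ inv elt_lt dlt _ _ src cls tcls clsM (e, b)).
Qed.

End Orders.

(** * Action of the fundamental group on normal forms *)

Section NormalFormAction.
Hypothesis E0_connected : forall v w, exists p, walk E0 v p w.
Hypothesis E0_acyclic : forall v p, walk E0 v p v -> reduced p -> p = [::].
Variable v0 : vertex Gam.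

Definition tree_path (v : vertex Gam) : seq D :=
  projT1 (cid (E0_connected v0 v)).

Lemma tree_pathP v : walk E0 v0 (tree_path v) v.
Proof. by rewrite /tree_path; case: cid. Qed.

(** A copy of the edge group inside the product. On it [dtrans] is an isomorphism onto the copy at
    the other end, whereas on the cylinder [esub] it forgets coordinates. *)
Definition strict_esub (d : D) : set P :=
  [set x | esub d x /\ x = single (x (src d))].

Lemma strict_esubP d x : strict_esub d x <-> exists c, x = single (dmap d c).
Proof.
split=> [[[c _ cE] ->]|[c ->]]; first by exists c; rewrite cE.
by split; [exists c => // | ]; rewrite single_same.
Qed.

Lemma strict_esub1 d : strict_esub d 1.
Proof. by apply/strict_esubP; exists 1; rewrite dmap1 single1. Qed.

Lemma strict_esubM d x y : strict_esub d x -> strict_esub d y -> strict_esub d (x * y).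
Proof.
move=> /strict_esubP[c ->] /strict_esubP[c' ->]; apply/strict_esubP.
by exists (c * c'); rewrite dmapM singleM.
Qed.

Lemma strict_esubV d x : strict_esub d x -> strict_esub d x^-1.
Proof.
move=> /strict_esubP[c ->]; apply/strict_esubP.
by exists (c^-1); rewrite dmapV singleV.
Qed.

Lemma dtrans_single d c : dtrans d (single (dmap d c)) = single (dmap (inv d) c).
Proof. by apply: dtransE; rewrite single_same. Qed.

Lemma strict_esub_dtrans d x : strict_esub d x -> strict_esub (inv d) (dtrans d x).
Proof.
by move=> /strict_esubP[c ->]; apply/strict_esubP; exists c; rewrite dtrans_single.
Qed.

Lemma dtransK d x : strict_esub d x -> dtrans (inv d) (dtrans d x) = x.
Proof.
move=> /strict_esubP[c ->]; rewrite dtrans_single (@dtrans_single (inv d) c).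
by case: d c => e b c; rewrite /inv /= negbK.
Qed.

Lemma dtransM d x y : strict_esub d x -> strict_esub d y ->
  dtrans d (x * y) = dtrans d x * dtrans d y.
Proof.
move=> /strict_esubP[c ->] /strict_esubP[c' ->].
by rewrite -singleM -dmapM !dtrans_single dmapM singleM.
Qed.

Local Notation dact := (dart_act inv strict_esub dtrans).
Local Notation stack := (nform_stack inv strict_esub).
Local Notation S := (nform P D).

Let dactK := dart_actK (@dinvK Gam) strict_esub1 strict_esubM strict_esubV
  strict_esub_dtrans dtransK.
Let dact_stack := @dart_act_stack _ _ inv _ dtrans strict_esub1 strict_esubM strict_esubV.

Definition walk_act (p : seq D) (s : S) : S := foldl (fun s d => dact d s) s p.

Definition walk_rev (p : seq D) : seq D := rev (map inv p).

Lemma walk_act_stack p s : stack s.2 -> stack (walk_act p s).2.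
Proof. by elim: p s => //= d p IH s hs; apply: IH; exact: dact_stack. Qed.

Lemma walk_act_cat p q s : walk_act (p ++ q) s = walk_act q (walk_act p s).
Proof. exact: foldl_cat. Qed.

Lemma walk_revK p s : stack s.2 -> walk_act (walk_rev p) (walk_act p s) = s.
Proof.
elim: p s => // d p IH s hs; rewrite /walk_rev /= rev_cons -cats1 walk_act_cat.
rewrite IH; [exact: dactK | exact: dact_stack].
Qed.

Lemma walk_revKr p s : stack s.2 -> walk_act p (walk_act (walk_rev p) s) = s.
Proof.
move=> hs; rewrite -{1}(_ : walk_rev (walk_rev p) = p) ?walk_revK //.
rewrite /walk_rev map_rev revK -map_comp -[RHS]map_id; apply: eq_map; exact: dinvK.
Qed.

(** A nonempty closed walk in the tree backtracks somewhere; removing the backtrack does not change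
    the action, and the walk gets shorter. *)
Lemma walk_act_closed v p s : walk E0 v p v -> stack s.2 -> walk_act p s = s.
Proof.
have [n] := ubnP (size p); elim: n p => // n IH p pn pw hs.
have [rp|/not_reduced[p1 [p2 [e [b pE]]]]] := pselect (reduced p).
  by rewrite (E0_acyclic pw rp).
subst p; rewrite walk_act_cat [walk_act (_ :: _) _]/= (dactK (e, b)); last first.
  exact: walk_act_stack.
rewrite -walk_act_cat; apply: IH => //.
  by move: pn; rewrite !size_cat /= !addnS ltnS => /ltnW.
case/walk_cat: pw => u [p1w [_ eu [_ _ p2w]]]; apply/walk_cat; exists u.
split=> //; move: p2w; congr (walk E0 _ _ _).
by rewrite -eu; case: b eu pn.
Qed.

Lemma walk_act_parallel v w p q s : walk E0 v p w -> walk E0 v q w ->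
  stack s.2 -> walk_act p s = walk_act q s.
Proof.
have wrev u p' u' : walk E0 u p' u' -> walk E0 u' (walk_rev p') u.
  elim: p' u => [|d p' IH] u /=; first by move->.
  case=> Ed du /IH pw; rewrite /walk_rev /= rev_cons -cats1; apply/walk_cat.
  exists (dart_tgt d); split=> //; split=> //; first exact: src_dinv.
  by rewrite -du -src_dinv dinvK.
move=> pw qw hs.
have /walk_act_closed/(_ hs) : walk E0 v (p ++ walk_rev q) v.
  by apply/walk_cat; exists w; split=> //; exact: wrev.
rewrite walk_act_cat => {2}<-; rewrite walk_revKr //; exact: walk_act_stack.
Qed.

(** A letter acts as a loop at [v0]: out along the tree, across the letter, and back along the tree.
    Thus a tree letter acts by a closed tree walk, that is trivially, although its dart alone does
    not. *)
Definition letter_act (a : letter GG) (s : S) : S :=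
  match a with
  | Elt v g => walk_act (walk_rev (tree_path v))
                 (elt_act (single g) (walk_act (tree_path v) s))
  | Stab e b => walk_act (walk_rev (tree_path (src (inv (e, b)))))
                  (dact (e, b) (walk_act (tree_path (src (e, b))) s))
  end.

Definition word_act (w : word GG) (s : S) : S := foldl (fun s a => letter_act a s) s w.

Lemma letter_act_stack a s : stack s.2 -> stack (letter_act a s).2.
Proof.
move=> hs; case: a => [v g|e b] /=; apply: walk_act_stack.
  exact: walk_act_stack.
by apply: dact_stack; exact: walk_act_stack.
Qed.

Lemma word_act_stack w s : stack s.2 -> stack (word_act w s).2.
Proof. by elim: w s => //= a w IH s hs; apply: IH; exact: letter_act_stack. Qed.

(** The defining relations are checked one by one. The stack condition is carried along because the
    cancellation of opposite darts is established for valid stacks. *)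
Lemma word_act_eq u w s : word_eq E0 u w -> stack s.2 -> word_act u s = word_act w s.
Proof.
move=> uw; elim: uw s => {u w}
  [w|w1 w2 _ h|w1 w2 w3 _ h1 _ h2|u1 u2 w1 w2 _ h1 _ h2|v|v g h|e b|e Ee|e c] s hs //=.
- by rewrite h.
- by rewrite h1 // h2.
- by rewrite /word_act !foldl_cat -!/(word_act _ _) h1 // h2 //; exact: word_act_stack.
- by rewrite single1 elt_act1 walk_revK.
- rewrite walk_revKr; first by rewrite elt_actM singleM.
  exact: walk_act_stack.
- have ws := walk_act_stack (tree_path (src (e, b))) hs.
  rewrite -[(e, ~~ b)]/(inv (e, b)) dinvK walk_revKr; last exact: dact_stack.
  by rewrite dactK // walk_revK.
(* The tree relation: the tree path to the start of e, followed by e, is a tree walk parallel to the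
   chosen path to the end of e. *)
- have ws := walk_act_stack (tree_path (src (e, true))) hs.
  rewrite -[RHS](walk_revK (tree_path (src (inv (e, true)))) hs).
  congr (walk_act _ _).
  have -> : dact (e, true) (walk_act (tree_path (src (e, true))) s) =
      walk_act (rcons (tree_path (src (e, true))) (e, true)) s.
    by rewrite -cats1 walk_act_cat.
  apply: (@walk_act_parallel v0 (src (inv (e, true)))) => //; last exact: tree_pathP.
  rewrite -cats1; apply/walk_cat; exists (src (e, true)).
  by split; [exact: tree_pathP | split].
- rewrite -[(e, ~~ true)]/(e, false) -[(e, ~~ false)]/(e, true).
  rewrite -[src (e, true)]/(init e) -[src (e, false)]/(term e).
  set s1 := walk_act (tree_path (term e)) s.
  have hs1 : stack s1.2 by exact: walk_act_stack.
  have hs2 : stack (dact (e, false) s1).2 by exact: dact_stack.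
  rewrite !walk_revKr //.
  have /(dart_act_slide inv strict_esub1 strict_esubM strict_esubV dtransM) slide :
      strict_esub (e, true) (single (init_map GG e c)).
    by apply/strict_esubP; exists c.
  rewrite slide (@dtrans_single (e, true) c) (dactK (e, false)) //.
Qed.

(** Keeps only the coordinate of each element that [eval] sees, so that the elements can be tested
    against [strict_esub]. *)
Definition restrict (l : seq (D * P)) : seq (D * P) :=
  [seq (x.1, single (x.2 (src (inv x.1)))) | x <- l].

Definition gallery_word (l : seq (D * P)) : word GG :=
  flatten [seq [:: Stab x.1.1 x.1.2; Elt (x.2 (src (inv x.1)))] | x <- l].

Lemma eval_gallery_word l : eval inv src cls tcls l = word_class E0 (gallery_word l).
Proof.
elim: l => [|[[e b] g] l IH] //=; rewrite IH /tcls /cls.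
by rewrite -(word_class_cat [:: _] [:: _]) -word_class_cat.
Qed.

Local Notation pact := (path_act inv strict_esub dtrans).

(** Consecutive letters of a path share a vertex, so the return along the tree after one letter
    cancels the way out before the next. *)
Lemma gallery_word_act v w l s : gallery inv src v l w -> stack s.2 ->
  word_act (gallery_word l) (walk_act (walk_rev (tree_path v)) s) =
  walk_act (walk_rev (tree_path w)) (pact (restrict l) s).
Proof.
elim: l v s => [|[[e b] g] l IH] v s; first by move=> <-.
case=> <- gl hs; have hs1 := dact_stack (e, b) hs.
have -> s' : word_act (gallery_word (((e, b), g) :: l)) s' =
    word_act (gallery_word l)
      (letter_act (Elt (g (src (inv (e, b))))) (letter_act (Stab e b) s')) by [].
rewrite [letter_act (Stab _ _) _]/letter_act walk_revKr // /letter_act walk_revKr //.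
exact: IH gl _.
Qed.

(** Applied to the empty normal form, a reduced path produces as many darts as it has; a path of
    value 1 therefore has none, and the remaining group element is read off. The case of the empty
    path is the injectivity of the vertex groups. *)
Lemma tpath1 elt_lt' dlt (l : seq (D * P)) (g : P) :
  (forall d d' x, turn elt_lt' dlt d x d' = 0%Z <-> d = d' /\ esub d x) ->
  gallery inv src v0 l v0 -> taut inv elt_lt' dlt l ->
  1 = cls v0 g * eval inv src cls tcls l -> l = [::] /\ g v0 = 1.
Proof.
move=> turn0 gl tl; rewrite eval_gallery_word /cls -word_class_cat => /esym/word_classP wE.
have hs0 : stack ((1, [::]) : S).2 by [].
have := word_act_eq wE (walk_act_stack (walk_rev (tree_path v0)) hs0).
rewrite /= walk_revKr // (gallery_word_act gl) // => /(congr1 (walk_act (tree_path v0))).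
have nb : no_backtrack inv strict_esub (restrict l).
  elim: l tl {gl wE} => [|[d x] l IH] //= [pt /IH {}IH]; split=> //.
  case: l pt {IH} => [|[d' x'] l] //= [//|tn] [dE [Ex _]]; apply: tn.
  by apply/turn0; split=> //; move: Ex; rewrite /esub -dE single_same.
rewrite !walk_revKr //; last first.
  by elim: (restrict l) {nb} (elt_act _ _) (hs0 : stack (elt_act (single (g v0)) (1, [::])).2)
     => //= -[d x] r IH s hs; apply: IH; exact: dact_stack.
move=> E; have /(congr1 size) := congr1 snd E.
rewrite (size_path_act strict_esub1 strict_esubM strict_esubV strict_esub_dtrans nb) //.
rewrite addn0 size_map => /size0nil l0; split=> //.
by have := congr1 fst E; rewrite l0 /= mul1g => sE; rewrite -[g v0]single_same sE.
Qed.

End NormalFormAction.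
End BassSerre.

(** * Orders on the fundamental group *)

Lemma total_order_exists (T : Type) : exists lt : T -> T -> Prop,
  (forall x y z, lt x y -> lt y z -> lt x z) /\
  (forall x y, exactly_one (lt x y) (x = y) (lt y x)).
Proof.
have [R woR] := well_ordering_principle {classic T}.
have woR' : {in <= predT, well_order R} by move=> A _; exact: woR.
have Rtot x y : R x y || R y x := wo_chainW woR' (isT : x \in predT) (isT : y \in predT).
have Ranti x y : R x y -> R y x -> x = y.
  by move=> xy yx; apply: (wo_chain_antisymmetric woR') => //; rewrite xy yx.
have Rtr x y z : R x y -> R y z -> R x z.
  move=> xy yz.
  (* Transitivity is read off from the least element of {x, y, z}. *)
  have [|m [[mA mmin] _]] := woR (pred3 x y z).
    by exists x; rewrite inE eqxx.
  have [mx my mz] : [/\ R m x, R m y & R m z].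
    by split; apply: mmin; rewrite !inE eqxx ?orbT.
  move: mA; rewrite !inE => /or3P[] /eqP mE; subst m => //.
    by rewrite (Ranti _ _ xy mx).
  by rewrite -(Ranti _ _ yz my).
exists (fun x y => R x y /\ x <> y); split=> [x y z [xy nxy] [yz nyz]|x y].
  by split; [exact: Rtr yz | move=> xz; subst z; case: nxy; exact: Ranti].
have [<-|nE] := pselect (x = y); first by constructor 2; split=> // -[].
case/orP: (Rtot x y) => h; [constructor 1 | constructor 3]; split=> //.
- by case=> h' _; apply: nE; exact: Ranti.
- by case=> h' _; apply: nE; exact: Ranti.
- by split=> // /esym.
Qed.

Section Main.
Local Open Scope group_scope.
Local Open Scope classical_set_scope.
Variables (Gam : graph) (GG : graph_of_groups Gam).
Variables (V0 : set (vertex Gam)) (E0 : set (edge Gam)).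
Hypothesis Gam_connected : connected_graph Gam.
Hypothesis T_maximal : maximal_subtree V0 E0.
Variables (lti : forall e, set (vgrp GG (init e)) -> set (vgrp GG (init e)) -> Prop)
  (ltt : forall e, set (vgrp GG (term e)) -> set (vgrp GG (term e)) -> Prop)
  (dlt : dart Gam -> dart Gam -> Prop).
Hypothesis lti_order : forall e, coset_order (range (init_map GG e)) (@lti e).
Hypothesis ltt_order : forall e, coset_order (range (term_map GG e)) (@ltt e).
Hypothesis dlt_trans : forall d1 d2 d3, dlt d1 d2 -> dlt d2 d3 -> dlt d1 d3.
Hypothesis dlt_tri : forall d d', exactly_one (dlt d d') (d = d') (dlt d' d).

Lemma tree_connected v w : exists p, walk E0 v p w.
Proof.
have sp := maximal_subtree_spanning Gam_connected T_maximal.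
by case: T_maximal => /subtree_connected sc _; exact: sc.
Qed.

Lemma tree_acyclic v p : walk E0 v p v -> reduced p -> p = [::].
Proof. exact: (subtree_acyclic (proj1 T_maximal)). Qed.

Definition fg_positive (v : vertex Gam) : set (fundamental_group GG E0) :=
  positive_elts (@dinv Gam) (@dfwd Gam) (elt_lt lti ltt) dlt (@dart_src Gam)
    (@cls _ GG E0) (@tcls _ GG E0) v.

Lemma vertex_subgroupE v : vertex_subgroup GG E0 v = range (@cls _ GG E0 v).
Proof.
apply/seteqP; split=> _ [x _ <-]; last by exists (x v).
by exists (single x) => //; rewrite /cls single_same.
Qed.

Lemma turn_elt_lt d d' x :
  turn (elt_lt lti ltt) dlt d x d' = 0%Z <-> d = d' /\ esub d x.
Proof. exact: (turn0P (elt_lt_tri lti_order ltt_order) dlt_tri). Qed.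

Lemma fg_positive_cone v : cone (vertex_subgroup GG E0 v) (fg_positive v).
Proof.
rewrite vertex_subgroupE.
apply: (positive_cone (@dinvK Gam) (@dfwd_inv Gam) (@esub_subgroup _ GG)
  (elt_lt_trans lti_order ltt_order) (elt_lt_tri lti_order ltt_order)
  (elt_ltM lti_order ltt_order) dlt_trans dlt_tri (@clsM _ GG E0) (@tcls_inv _ GG E0)
  (@esub_dtrans _ GG) (@cls_tcls _ GG E0)).
  by move=> x; apply: tpath_ex => //; exact: tree_connected.
by move=> l [gl tl [g]] /(tpath1 tree_connected tree_acyclic turn_elt_lt gl tl) [].
Qed.

Lemma vertex_elt_inj v (g : vgrp GG v) : word_class E0 [:: Elt g] = 1 -> g = 1.
Proof.
move=> gE; have sE : 1 = cls E0 v (single g) * 1 by rewrite /cls single_same gE mulg1.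
have [_] := @tpath1 _ GG E0 tree_connected tree_acyclic v _ dlt [::] (single g)
  turn_elt_lt erefl I sE.
by rewrite single_same.
Qed.

Definition fg_lt (v : vertex Gam) (ltv : vgrp GG v -> vgrp GG v -> Prop)
    (x y : fundamental_group GG E0) : Prop :=
  fg_positive v (x^-1 * y) \/
  exists2 g : vgrp GG v, ltv 1 g & x^-1 * y = word_class E0 [:: Elt g].

Lemma fg_lt_order v ltv : left_order ltv -> left_order (@fg_lt v ltv).
Proof.
move=> [[ltr ltri] ltM].
pose Q : set (fundamental_group GG E0) :=
  [set x | exists2 g : vgrp GG v, ltv 1 g & x = word_class E0 [:: Elt g]].
pose c (g : vgrp GG v) : fundamental_group GG E0 := word_class E0 [:: Elt g].
have cM g h : c (g * h) = c g * c h.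
  by rewrite /c -word_class_cat; apply/word_classP/word_sym; exact: word_mul.
have c1 : c 1 = 1 by apply: (@mulgI _ (c 1)); rewrite -cM !mulg1.
have cV g : c g^-1 = (c g)^-1 by apply: (@mulgI _ (c g)); rewrite -cM !mulgV c1.
have cI g h : c g = c h -> g = h.
  move=> E; rewrite -[h](mulVKg g); suff -> : g^-1 * h = 1 by rewrite mulg1.
  by apply: vertex_elt_inj; rewrite -/(c _) cM cV E mulVg.
have QE g : Q (c g) <-> ltv 1 g.
  by split=> [[h hP /cI ->] //|gP]; exists g.
apply: (@cone_left_order _ _ _ Q (fg_positive_cone v)).
- by move=> _ [g _ ->]; exists g.
- move=> _ _ [g gP ->] [h hP ->]; exists (g * h); last exact: esym (cM g h).
  by apply: (ltr _ g) => //; have := ltM g _ _ hP; rewrite mulg1.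
- move=> _ [g _ <-]; rewrite -/(c g) -cV.
  have -> : Q (c g) = ltv 1 g by rewrite propeqE.
  have -> : Q (c g^-1) = ltv g 1.
    rewrite propeqE; split=> [/QE/(ltM g)|/(ltM g^-1)]; first by rewrite mulgV mulg1.
    by rewrite mulVg mulg1 => /QE.
  have -> : (c g = 1) = (1 = g).
    by rewrite propeqE; split=> [gE|<-//]; apply: cI; rewrite gE c1.
  exact: ltri.
Qed.

End Main.

(** * Closure properties of computable functions *)

Section Computability.
Variable O : set (nat -> nat).
Local Notation comp := (computable_in O).
Implicit Types f g h : seq nat -> nat.

Lemma comp_ext f g : f =1 g -> comp f -> comp g.
Proof. by move=> /funext ->. Qed.

Lemma comp_nth i : comp (fun s => nth 0 s i). Proof. exact: comp_proj. Qed.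

Lemma comp_list1 f g : comp f -> comp g -> comp (fun s => f [:: g s]).
Proof.
move=> hf hg; apply: (@comp_comp O f [:: g]) => // -[|i] //=.
by rewrite nth_nil; exact: comp_zero.
Qed.

Lemma comp_list2 f g1 g2 : comp f -> comp g1 -> comp g2 ->
  comp (fun s => f [:: g1 s; g2 s]).
Proof.
move=> hf h1 h2; apply: (@comp_comp O f [:: g1; g2]) => // -[|[|i]] //=.
by rewrite nth_nil; exact: comp_zero.
Qed.

Lemma comp_list3 f g1 g2 g3 : comp f -> comp g1 -> comp g2 -> comp g3 ->
  comp (fun s => f [:: g1 s; g2 s; g3 s]).
Proof.
move=> hf h1 h2 h3; apply: (@comp_comp O f [:: g1; g2; g3]) => // -[|[|[|i]]] //=.
by rewrite nth_nil; exact: comp_zero.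
Qed.

Lemma comp_fun1 (F : nat -> nat) : comp (fun s => F (nth 0 s 0)) ->
  forall g, comp g -> comp (fun s => F (g s)).
Proof. by move=> hF g hg; exact: (comp_list1 hF hg). Qed.

Lemma comp_fun2 (F : nat -> nat -> nat) : comp (fun s => F (nth 0 s 0) (nth 0 s 1)) ->
  forall g1 g2, comp g1 -> comp g2 -> comp (fun s => F (g1 s) (g2 s)).
Proof. by move=> hF g1 g2 h1 h2; exact: (comp_list2 hF h1 h2). Qed.

Lemma comp_fun3 (F : nat -> nat -> nat -> nat) :
  comp (fun s => F (nth 0 s 0) (nth 0 s 1) (nth 0 s 2)) ->
  forall g1 g2 g3, comp g1 -> comp g2 -> comp g3 ->
    comp (fun s => F (g1 s) (g2 s) (g3 s)).
Proof. by move=> hF g1 g2 g3 h1 h2 h3; exact: (comp_list3 hF h1 h2 h3). Qed.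

Lemma comp_S f : comp f -> comp (fun s => (f s).+1).
Proof. by apply: comp_fun1; apply: comp_ext (comp_succ O); case. Qed.

Lemma comp_const n : comp (fun=> n).
Proof. by elim: n => [|n IH]; [exact: comp_zero | exact: comp_S]. Qed.

Lemma comp_nat_rect (B : nat -> nat) (S : nat -> nat -> nat -> nat) :
  comp (fun s => B (nth 0 s 0)) ->
  comp (fun s => S (nth 0 s 0) (nth 0 s 1) (nth 0 s 2)) ->
  forall n p, comp n -> comp p ->
  comp (fun s => nat_rect (fun=> nat) (B (p s)) (fun k r => S k r (p s)) (n s)).
Proof.
move=> hB hS; pose F n p := nat_rect (fun=> nat) (B p) (fun k r => S k r p) n.
apply: (@comp_fun2 F); apply: comp_ext (comp_rec hB hS) => s /=.
by case: s => [|n [|p s]].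
Qed.

Lemma comp_pred f : comp f -> comp (fun s => (f s).-1).
Proof.
apply: (@comp_fun1 predn); apply: comp_ext (comp_nat_rect (B := fun=> 0)
  (S := fun k _ _ => k) (comp_const 0) (comp_nth 0) (comp_nth 0) (comp_nth 0)) => s.
by case: (nth 0 s 0).
Qed.

Lemma comp_add f g : comp f -> comp g -> comp (fun s => f s + g s).
Proof.
apply: (@comp_fun2 addn); apply: comp_ext (comp_nat_rect (B := id)
  (S := fun _ r _ => r.+1) (comp_nth 0) (comp_S (comp_nth 1)) (comp_nth 0) (comp_nth 1)).
by move=> s; elim: (nth 0 s 0) => //= n ->; rewrite addSn.
Qed.

Lemma comp_sub f g : comp f -> comp g -> comp (fun s => f s - g s).
Proof.
apply: (@comp_fun2 subn); apply: comp_ext (comp_nat_rect (B := id)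
  (S := fun _ r _ => r.-1) (comp_nth 0) (comp_pred (comp_nth 1)) (comp_nth 1) (comp_nth 0)).
by move=> s; elim: (nth 0 s 1) => [|n /= ->]; rewrite ?subn0 ?subnS.
Qed.

Lemma comp_mul f g : comp f -> comp g -> comp (fun s => f s * g s).
Proof.
apply: (@comp_fun2 muln); apply: comp_ext (comp_nat_rect (B := fun=> 0)
  (S := fun _ r p => p + r) (comp_const 0) (comp_add (comp_nth 2) (comp_nth 1))
  (comp_nth 0) (comp_nth 1)).
by move=> s; elim: (nth 0 s 0) => //= n ->; rewrite mulSn.
Qed.

Lemma comp_exp2 f : comp f -> comp (fun s => 2 ^ f s).
Proof.
apply: (@comp_fun1 (expn 2)); apply: comp_ext (comp_nat_rect (B := fun=> 1)
  (S := fun _ r _ => r + r) (comp_const 1) (comp_add (comp_nth 1) (comp_nth 1))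
  (comp_nth 0) (comp_nth 0)).
by move=> s; elim: (nth 0 s 0) => //= n ->; rewrite expnS mul2n addnn.
Qed.

Lemma comp_eq0 f : comp f -> comp (fun s => (f s == 0) : nat).
Proof.
move=> hf; apply: comp_ext (comp_sub (comp_const 1) hf) => s.
by case: (f s) => [|[]].
Qed.

Lemma comp_negb (b : seq nat -> bool) : comp (fun s => b s : nat) ->
  comp (fun s => ~~ b s : nat).
Proof. by move=> /comp_eq0; apply: comp_ext => s; case: (b s). Qed.

Lemma comp_neq0 f : comp f -> comp (fun s => (f s != 0) : nat).
Proof. by move=> hf; apply: comp_negb; exact: comp_eq0. Qed.

Lemma comp_andb (b c : seq nat -> bool) : comp (fun s => b s : nat) ->
  comp (fun s => c s : nat) -> comp (fun s => (b s && c s) : nat).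
Proof. by move=> hb hc; apply: comp_ext (comp_mul hb hc) => s; rewrite mulnb. Qed.

Lemma comp_orb (b c : seq nat -> bool) : comp (fun s => b s : nat) ->
  comp (fun s => c s : nat) -> comp (fun s => (b s || c s) : nat).
Proof.
move=> hb hc; apply: comp_ext (comp_negb (comp_andb (comp_negb hb) (comp_negb hc))) => s.
by rewrite negb_and !negbK.
Qed.

Lemma comp_leq f g : comp f -> comp g -> comp (fun s => (f s <= g s) : nat).
Proof. by move=> hf hg; exact: comp_eq0 (comp_sub hf hg). Qed.

Lemma comp_eq f g : comp f -> comp g -> comp (fun s => (f s == g s) : nat).
Proof.
move=> hf hg; apply: comp_ext (comp_andb (comp_leq hf hg) (comp_leq hg hf)) => s.
by rewrite eqn_leq.
Qed.

Lemma comp_eqb (b c : seq nat -> bool) : comp (fun s => b s : nat) ->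
  comp (fun s => c s : nat) -> comp (fun s => (b s == c s) : nat).
Proof.
by move=> hb hc; apply: comp_ext (comp_eq hb hc) => s; case: (b s); case: (c s).
Qed.

Lemma comp_if (b : seq nat -> bool) f g : comp (fun s => b s : nat) -> comp f ->
  comp g -> comp (fun s => if b s then f s else g s).
Proof.
move=> hb hf hg.
apply: comp_ext (comp_add (comp_mul hb hf) (comp_mul (comp_negb hb) hg)) => s.
by case: (b s); rewrite ?mul1n ?mul0n ?addn0.
Qed.

Lemma comp_ex_minn1 (Q : nat -> nat -> bool) (exQ : forall p, exists k, Q p k) :
  comp (fun s => Q (nth 0 s 1) (nth 0 s 0) : nat) ->
  forall p, comp p -> comp (fun s => ex_minn (exQ (p s))).
Proof.
move=> hQ; apply: (@comp_fun1 (fun p => ex_minn (exQ p))).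
have hF := comp_negb hQ; set F := (fun s => _) in hF.
have f0 s : exists k, F (k :: s) == 0.
  by have [k hk] := exQ (nth 0 s 0); exists k; rewrite /F /= hk.
apply: comp_ext (comp_mu f0 hF) => s; apply: eq_ex_minn => k; rewrite /F /=.
by case: (Q _ _).
Qed.

Lemma comp_ex_minn2 (Q : nat -> nat -> nat -> bool) (exQ : forall p q, exists k, Q p q k) :
  comp (fun s => Q (nth 0 s 1) (nth 0 s 2) (nth 0 s 0) : nat) ->
  forall p q, comp p -> comp q -> comp (fun s => ex_minn (exQ (p s) (q s))).
Proof.
move=> hQ; apply: (@comp_fun2 (fun p q => ex_minn (exQ p q))).
have hF := comp_negb hQ; set F := (fun s => _) in hF.
have f0 s : exists k, F (k :: s) == 0.
  by have [k hk] := exQ (nth 0 s 0) (nth 0 s 1); exists k; rewrite /F /= hk.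
apply: comp_ext (comp_mu f0 hF) => s; apply: eq_ex_minn => k; rewrite /F /=.
by case: (Q _ _ _).
Qed.

(** The quotient is the least k with m < (k + 1) d. The disjunct d = 0 makes the search total and
    returns 0, the conventional value. *)
Lemma comp_divn f g : comp f -> comp g -> comp (fun s => f s %/ g s).
Proof.
pose Q m d k := (d == 0) || (m < k.+1 * d).
have exQ m d : exists k, Q m d k.
  by exists m; rewrite /Q; case: d => //= d; exact: leq_pmulr.
have hQ : comp (fun s => Q (nth 0 s 1) (nth 0 s 2) (nth 0 s 0) : nat).
  apply: comp_orb (comp_eq0 (comp_nth 2)) (comp_leq (comp_S (comp_nth 1)) _).
  exact: comp_mul (comp_S (comp_nth 0)) (comp_nth 2).
move=> hf hg; apply: comp_ext (comp_ex_minn2 exQ hQ hf hg) => s.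
case: ex_minnP => k; rewrite /Q; case: (g s) => [|d] /=.
  by move=> _ /(_ 0 isT); rewrite leqn0 => /eqP ->; rewrite divn0.
move=> h1 h2; apply/eqP; rewrite eqn_leq h2 /=; first by rewrite -ltnS ltn_divLR.
by rewrite -ltn_divLR.
Qed.

(** One step of [CodeSeq.code]: the head is the 2-adic valuation of the code. The empty list has
    code 0, whose [phd] and [ptl] are 0. *)
Definition pcons (n m : nat) : nat := 2 ^ n * m.*2.+1.
Definition phd (m : nat) : nat := head 0 (CodeSeq.decode m).
Definition ptl (m : nat) : nat := CodeSeq.code (behead (CodeSeq.decode m)).

Lemma decode_pcons n m : CodeSeq.decode (pcons n m) = n :: CodeSeq.decode m.
Proof. by rewrite -[in LHS](CodeSeq.decodeK m) (CodeSeq.codeK (n :: _)). Qed.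

Lemma phd_pcons n m : phd (pcons n m) = n. Proof. by rewrite /phd decode_pcons. Qed.

Lemma ptl_pcons n m : ptl (pcons n m) = m.
Proof. by rewrite /ptl decode_pcons CodeSeq.decodeK. Qed.

Lemma pcons_eq0 n m : (pcons n m == 0) = false.
Proof. by rewrite muln_eq0 expn_eq0. Qed.

Lemma pcons_phd_ptl m : m != 0 -> pcons (phd m) (ptl m) = m.
Proof.
move=> m0; rewrite -[RHS]CodeSeq.decodeK /phd /ptl.
have : CodeSeq.decode m <> [::] by move=> E; rewrite -(CodeSeq.decodeK m) E in m0.
by case: (CodeSeq.decode m).
Qed.

Lemma comp_pcons f g : comp f -> comp g -> comp (fun s => pcons (f s) (g s)).
Proof.
move=> hf hg; apply: comp_ext (comp_mul (comp_exp2 hf) (comp_S (comp_add hg hg))) => s.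
by rewrite addnn.
Qed.

(** The valuation is the least k such that 2^(k+1) does not divide m; for m = 0 the search stops at
    once, at the default head 0. *)
Lemma comp_phd f : comp f -> comp (fun s => phd (f s)).
Proof.
pose Q m k := (m == 0) || (m %/ 2 ^ k.+1 * 2 ^ k.+1 != m).
have Qk n m k : Q (pcons n m) k = (n <= k).
  rewrite /Q pcons_eq0 /= -dvdn_eq /pcons; have [nk|kn] := leqP n k.
    apply/negP => h; have : 2 ^ n.+1 %| 2 ^ n * m.*2.+1.
      by apply: dvdn_trans h; exact: dvdn_exp2l.
    by rewrite expnSr dvdn_pmul2l ?expn_gt0 // dvdn2 /= odd_double.
  by rewrite (dvdn_trans (dvdn_exp2l 2 kn)) // dvdn_mulr.
have exQ m : exists k, Q m k.
  have [->|m0] := eqVneq m 0; first by exists 0.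
  by exists (phd m); rewrite -{1}(pcons_phd_ptl m0) Qk.
have hQ : comp (fun s => Q (nth 0 s 1) (nth 0 s 0) : nat).
  apply: comp_orb (comp_eq0 (comp_nth 1)) (comp_negb (comp_eq _ (comp_nth 1))).
  have h2 := comp_exp2 (comp_S (comp_nth 0)).
  exact: comp_mul (comp_divn (comp_nth 1) h2) h2.
move=> hf; apply: comp_ext (comp_ex_minn1 exQ hQ hf) => s; case: ex_minnP => k.
have [->|m0] := eqVneq (f s) 0.
  by move=> _ /(_ 0 isT); rewrite leqn0 => /eqP ->.
rewrite -{1 2}(pcons_phd_ptl m0) Qk => h1 h2; apply/eqP; rewrite eqn_leq h1 andbT.
by apply: h2; rewrite Qk.
Qed.

Lemma comp_ptl f : comp f -> comp (fun s => ptl (f s)).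
Proof.
move=> hf; apply: comp_ext (comp_divn hf (comp_exp2 (comp_S (comp_phd hf)))) => s.
have [->|m0] := eqVneq (f s) 0; first by rewrite div0n.
rewrite -{1}(pcons_phd_ptl m0) /pcons expnSr divnMA mulKn ?expn_gt0 //.
by rewrite divn2 /= uphalf_double.
Qed.

Lemma comp_foldl (F : nat -> nat -> nat -> nat) :
  comp (fun s => F (nth 0 s 0) (nth 0 s 1) (nth 0 s 2)) ->
  forall p st m, comp p -> comp st -> comp m ->
  comp (fun s => foldl (F (p s)) (st s) (CodeSeq.decode (m s))).
Proof.
move=> hF; apply: (@comp_fun3 (fun p st m => foldl (F p) st (CodeSeq.decode m))).
(* The step ignores its counter and is stationary once the input is exhausted, so any number of
   iterations that is at least the length will do. *)
pose S (k X p : nat) := if ptl X == 0 then X else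
  pcons (F p (phd X) (phd (ptl X))) (ptl (ptl X)).
have hS : comp (fun s => S (nth 0 s 0) (nth 0 s 1) (nth 0 s 2)).
  have h1 := comp_nth 1; have t1 := comp_ptl h1.
  apply: (comp_if (comp_eq0 t1) h1); apply: (comp_pcons _ (comp_ptl t1)).
  exact: (comp_fun3 hF (comp_nth 2) (comp_phd h1) (comp_phd t1)).
(* The accumulator is the pair of the current state and the unread input; the
   code of a list bounds its length, hence the number of iterations. *)
have hR : comp (fun s => phd (nat_rect (fun=> nat) (ptl (pcons (nth 0 s 0)
    (pcons (nth 0 s 1) (nth 0 s 2)))) (fun k r => S k r (phd (pcons (nth 0 s 0)
    (pcons (nth 0 s 1) (nth 0 s 2))))) (nth 0 s 2))).
  apply: comp_phd; apply: (comp_nat_rect (B := ptl) (S := fun k r q => S k r (phd q))).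
  - exact: comp_ptl (comp_nth 0).
  - exact: (comp_fun3 hS (comp_nth 0) (comp_nth 1) (comp_phd (comp_nth 2))).
  - exact: comp_nth.
  - exact: comp_pcons (comp_nth 0) (comp_pcons (comp_nth 1) (comp_nth 2)).
apply: comp_ext hR => s; rewrite ptl_pcons phd_pcons.
move: (nth 0 s 0) (nth 0 s 1) (nth 0 s 2) => p st m.
have szm : size (CodeSeq.decode m) <= m.
  rewrite -[X in _ <= X]CodeSeq.decodeK.
  elim: (CodeSeq.decode m) => //= n l IH; rewrite -[X in X <= _]mul1n.
  by rewrite leq_mul ?expn_gt0 // ltnS -addnn (leq_trans IH) // leq_addr.
have shift k X : nat_rect (fun=> nat) (S 0 X p) (fun k r => S k r p) k
    = S 0 (nat_rect (fun=> nat) X (fun k r => S k r p) k) p.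
  by elim: k => //= k ->.
have iterE l st' n : size l <= n ->
    nat_rect (fun=> nat) (pcons st' (CodeSeq.code l)) (fun k r => S k r p) n =
    pcons (foldl (F p) st' l) 0.
  elim: l st' n => [|a l IH] st' [|n] //.
    by move=> _; elim: n => [|n /= ->]; rewrite /= /S ptl_pcons.
  move=> /(IH (F p st' a)) /= <-; rewrite -[S n _ p]/(S 0 _ p) -shift.
  by congr nat_rect; rewrite /S -/(pcons _ _) ptl_pcons pcons_eq0 !phd_pcons ptl_pcons.
by rewrite -{1}(CodeSeq.decodeK m) iterE // phd_pcons.
Qed.

End Computability.

(** * Computing the orders *)

Arguments dmap {Gam GG} d _.

Section PathWords.
Local Open Scope group_scope.
Local Open Scope classical_set_scope.
Variables (Gam : graph) (GG : graph_of_groups Gam) (E0 : set (edge Gam)).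
Implicit Types (a : letter GG) (u w : word GG).

Definition letter_src a : vertex Gam :=
  match a with Elt v _ => v | Stab e b => dart_src (e, b) end.

Definition letter_tgt a : vertex Gam :=
  match a with Elt v _ => v | Stab e b => dart_src (dinv (e, b)) end.

Fixpoint path_word (v : vertex Gam) (p : word GG) (w : vertex Gam) : Prop :=
  if p is a :: p' then letter_src a = v /\ path_word (letter_tgt a) p' w else v = w.

Definition tree_letter a : bool := if a is Stab e b then `[< E0 e >] else false.

Definition erase_tree w : word GG := [seq a <- w | ~~ tree_letter a].

Lemma word_class_erase w : word_class E0 (erase_tree w) = word_class E0 w.
Proof.
elim: w => [|a w IH] //=; rewrite -[a :: w]cat1s word_class_cat -IH.
case: ifPn => [_|]; first by rewrite -word_class_cat.
rewrite negbK; case: a => // e b /asboolP Ee.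
by rewrite -[word_class _ _ * _]/(tcls GG E0 (e, b) * _) tcls_tree // mul1g.
Qed.

Lemma path_word_cat x p y q z :
  path_word x p y -> path_word y q z -> path_word x (p ++ q) z.
Proof. by elim: p x => [|a p IH] x /=; [move-> | move=> [-> /IH h] /h]. Qed.

(** Tree walks inserted between consecutive letters make any word composable, and [erase_tree]
    removes them again. *)
Lemma path_word_ex w : (forall x y, exists p, walk E0 x p y) ->
  forall x y, exists p, path_word x p y /\ erase_tree p = erase_tree w.
Proof.
move=> conn.
have tree x y : exists p, path_word x p y /\ erase_tree p = [::].
  have [p] := conn x y; elim: p x => [|[e b] p IH] x /=; first by exists [::].
  case=> Ee <- /IH[q [qw q0]]; exists (Stab e b :: q); split.
    by split=> //; rewrite -[letter_tgt _]/(dart_src (dinv (e, b))) src_dinv.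
  by rewrite /erase_tree /= asboolT.
elim: w => [|a w IH] x y; first exact: tree.
have [p [pw p0]] := tree x (letter_src a); have [q [qw q0]] := IH (letter_tgt a) y.
exists (p ++ a :: q); split; first by apply: path_word_cat pw _.
by rewrite /erase_tree filter_cat -/(erase_tree p) p0 /= -!/(erase_tree _) q0.
Qed.

End PathWords.

(** * Algorithms on codes and their correctness *)

Section Algorithm.
Local Open Scope group_scope.
Local Open Scope classical_set_scope.
Variables (O : set (nat -> nat)) (Gam : graph) (GG : graph_of_groups Gam).
Variables (V0 : set (vertex Gam)) (E0 : set (edge Gam)).
Hypothesis Gam_connected : connected_graph Gam.
Hypothesis T_maximal : maximal_subtree V0 E0.
Variable C : coding GG.
Variables (lti : forall e, set (vgrp GG (init e)) -> set (vgrp GG (init e)) -> Prop)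
  (ltt : forall e, set (vgrp GG (term e)) -> set (vgrp GG (term e)) -> Prop).
Hypothesis lti_order : forall e, coset_order (range (init_map GG e)) (@lti e).
Hypothesis ltt_order : forall e, coset_order (range (term_map GG e)) (@ltt e).

Local Notation P := (vprod GG).
Local Notation D := (dart Gam).
Local Notation src := (@dart_src Gam).
Local Notation ecode := (@ecode _ _ C).
Local Notation vcode := (@vcode _ _ C).
Local Notation vgcode := (@vgcode _ _ C _).
Local Notation egcode := (@egcode _ _ C _).
Local Notation comp := (computable_in O).

(** A total order of the darts that can be decided from codes, with the orientation as lowest
    bit. *)
Definition dart_lt (d d' : D) : Prop :=
  (ecode d.1).*2 + d.2 < (ecode d'.1).*2 + d'.2.

Lemma dart_lt_trans d1 d2 d3 : dart_lt d1 d2 -> dart_lt d2 d3 -> dart_lt d1 d3.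
Proof. exact: ltn_trans. Qed.

Lemma dart_lt_tri d d' : exactly_one (dart_lt d d') (d = d') (dart_lt d' d).
Proof.
have inj : (ecode d.1).*2 + d.2 = (ecode d'.1).*2 + d'.2 -> d = d'.
  case: d d' => [e b] [e' b'] /= E; have bE : b = b'.
    by have := congr1 odd E; rewrite !oddD !odd_double !oddb.
  subst b'; move/addIn/double_inj/(@ecode_inj _ _ C): E => ->; by [].
rewrite /dart_lt; case: ltngtP => [h|h|/inj dE].
- by constructor 1; split=> // E; rewrite E ltnn in h.
- by constructor 3; split=> // E; rewrite E ltnn in h.
- by constructor 2.
Qed.

Variables fV fE fVG fEG fI fT fTree fVM fIM fTM fLI fLT : seq nat -> nat.
Hypothesis cV : comp fV.
Hypothesis cE : comp fE.
Hypothesis cVG : comp fVG.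
Hypothesis cEG : comp fEG.
Hypothesis cI : comp fI.
Hypothesis cT : comp fT.
Hypothesis cTree : comp fTree.
Hypothesis cVM : comp fVM.
Hypothesis cIM : comp fIM.
Hypothesis cTM : comp fTM.
Hypothesis cLI : comp fLI.
Hypothesis cLT : comp fLT.
Hypothesis fVE : forall m, fV [:: m] = `[< exists v, m = vcode v >].
Hypothesis fEE : forall m, fE [:: m] = `[< exists e, m = ecode e >].
Hypothesis fVGE : forall m n, fVG [:: m; n] =
  `[< exists v (g : vgrp GG v), m = vcode v /\ n = vgcode g >].
Hypothesis fEGE : forall m n, fEG [:: m; n] =
  `[< exists e (c : egrp GG e), m = ecode e /\ n = egcode c >].
Hypothesis fIE : forall e, fI [:: ecode e] = vcode (init e).
Hypothesis fTE : forall e, fT [:: ecode e] = vcode (term e).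
Hypothesis fTreeE : forall e, fTree [:: ecode e] = `[< E0 e >].
Hypothesis fVME : forall v (g h : vgrp GG v),
  fVM [:: vcode v; vgcode g; vgcode h] = vgcode (g * h).
Hypothesis fIME : forall e (c : egrp GG e),
  fIM [:: ecode e; egcode c] = vgcode (init_map GG e c).
Hypothesis fTME : forall e (c : egrp GG e),
  fTM [:: ecode e; egcode c] = vgcode (term_map GG e c).
Hypothesis fLIE : forall e (g h : vgrp GG (init e)),
  fLI [:: ecode e; vgcode g; vgcode h] =
  `[< lti (ltranslate g (range (init_map GG e)))
          (ltranslate h (range (init_map GG e))) >].
Hypothesis fLTE : forall e (g h : vgrp GG (term e)),
  fLT [:: ecode e; vgcode g; vgcode h] =
  `[< ltt (ltranslate g (range (term_map GG e)))
          (ltranslate h (range (term_map GG e))) >].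

Lemma fV_code v : fV [:: vcode v] = 1%N.
Proof. by rewrite fVE asboolT //; exists v. Qed.

Lemma fE_code e : fE [:: ecode e] = 1%N.
Proof. by rewrite fEE asboolT //; exists e. Qed.

Lemma fVG_code v (g : vgrp GG v) : fVG [:: vcode v; vgcode g] = 1%N.
Proof. by rewrite fVGE asboolT //; exists v, g. Qed.

Lemma fEG_code e (c : egrp GG e) : fEG [:: ecode e; egcode c] = 1%N.
Proof. by rewrite fEGE asboolT //; exists e, c. Qed.

Lemma fV_inv m : fV [:: m] != 0%N -> exists v, m = vcode v.
Proof. by rewrite fVE; case: asboolP. Qed.

Lemma fE_inv m : fE [:: m] != 0%N -> exists e, m = ecode e.
Proof. by rewrite fEE; case: asboolP. Qed.

Lemma fVG_inv v n : fVG [:: vcode v; n] != 0%N -> exists g : vgrp GG v, n = vgcode g.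
Proof.
rewrite fVGE; case: asboolP => // -[v' [g [/(@vcode_inj _ _ C) vE ->]]] _.
by subst v'; exists g.
Qed.

Lemma fEG_inv e n : fEG [:: ecode e; n] != 0%N -> exists c : egrp GG e, n = egcode c.
Proof.
rewrite fEGE; case: asboolP => // -[e' [c [/(@ecode_inj _ _ C) eE ->]]] _.
by subst e'; exists c.
Qed.

Definition c_src (e b : nat) : nat := if b != 0%N then fI [:: e] else fT [:: e].
Definition c_tgt (e b : nat) : nat := if b != 0%N then fT [:: e] else fI [:: e].
Definition c_dmap (e b c : nat) : nat := if b != 0%N then fIM [:: e; c] else fTM [:: e; c].
Definition c_lt (e b g h : nat) : nat :=
  if b != 0%N then fLI [:: e; g; h] else fLT [:: e; g; h].

Lemma c_srcE (d : D) : c_src (ecode d.1) d.2 = vcode (src d).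
Proof. by case: d => e []; [exact: fIE | exact: fTE]. Qed.

Lemma c_tgtE (d : D) : c_tgt (ecode d.1) d.2 = vcode (src (dinv d)).
Proof. by case: d => e []; [exact: fTE | exact: fIE]. Qed.

Lemma c_dmapE (d : D) (c : egrp GG d.1) : c_dmap (ecode d.1) d.2 (egcode c) = vgcode (dmap d c).
Proof. by case: d c => e [] c; [exact: fIME | exact: fTME]. Qed.

Lemma c_ltE (d : D) (x y : P) : c_lt (ecode d.1) d.2 (vgcode (x (src d))) (vgcode (y (src d))) =
  `[< elt_lt lti ltt d x y >].
Proof. by case: d => e []; [exact: fLIE | exact: fLTE]. Qed.

(** The identity is the only idempotent of a group, so multiplication suffices to find it. The first
    disjunct makes the search end on numbers that code no vertex, as minimization must be total. *)
Lemma one_ex v : exists n, (fV [:: v] == 0%N) ||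
  (fVG [:: v; n] != 0%N) && (fVM [:: v; n; n] == n).
Proof.
have [_|/fV_inv[w ->]] := eqVneq (fV [:: v]) 0%N; first by exists 0%N.
by exists (vgcode (1 : vgrp GG w)); rewrite fVG_code fVME mulg1 eqxx orbT.
Qed.

Definition c_one (v : nat) : nat := ex_minn (one_ex v).

Lemma c_oneE v : c_one (vcode v) = vgcode (1 : vgrp GG v).
Proof.
rewrite /c_one; case: ex_minnP => n; rewrite fV_code /= => /andP[/fVG_inv[g ->]].
rewrite fVME => /eqP/(@vgcode_inj _ _ C _) gg _; congr (vgcode _).
by apply: (@mulgI _ g); rewrite gg mulg1.
Qed.

Lemma inv_ex v g : exists n, (fV [:: v] == 0%N) || (fVG [:: v; g] == 0%N) ||
  (fVG [:: v; n] != 0%N) && (fVM [:: v; g; fVM [:: v; g; n]] == g).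
Proof.
have [_|/fV_inv[w ->]] := eqVneq (fV [:: v]) 0%N; first by exists 0%N.
have [_|/fVG_inv[h ->]] := eqVneq (fVG [:: vcode w; g]) 0%N.
  by exists 0%N; rewrite orbT.
by exists (vgcode h^-1); rewrite fVG_code !fVME mulgV mulg1 eqxx orbT.
Qed.

Definition c_inv (v g : nat) : nat := ex_minn (inv_ex v g).

Lemma c_invE v (g : vgrp GG v) : c_inv (vcode v) (vgcode g) = vgcode g^-1.
Proof.
rewrite /c_inv; case: ex_minnP => n; rewrite fV_code fVG_code /= => /andP[/fVG_inv[h ->]].
rewrite !fVME => /eqP/(@vgcode_inj _ _ C _) gg _; congr (vgcode _).
by apply: (@mulgI _ g); rewrite mulgV; apply: (@mulgI _ g); rewrite gg mulg1.
Qed.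

(** By trichotomy the coset order decides the edge subgroup: g belongs to it exactly when neither of
    the cosets of g and of 1 lies below the other. *)
Definition c_in (e b g : nat) : bool :=
  (c_lt e b g (c_one (c_src e b)) == 0%N) && (c_lt e b (c_one (c_src e b)) g == 0%N).

Lemma c_inE (d : D) (x : P) : c_in (ecode d.1) d.2 (vgcode (x (src d))) = `[< esub d x >].
Proof.
rewrite /c_in c_srcE c_oneE -[1]/((1 : P) (src d)) !c_ltE.
have := elt_lt_tri lti_order ltt_order d 1 x; rewrite invg1 mul1g.
by case=> -[h1 h2 h3]; rewrite ?(asboolT h1) ?(asboolF h1) ?(asboolT h2) ?(asboolF h2)
  ?(asboolT h3) ?(asboolF h3).
Qed.

Definition p0 (m : nat) : nat := phd m.
Definition p1 (m : nat) : nat := phd (ptl m).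
Definition p2 (m : nat) : nat := phd (ptl (ptl m)).
Definition triple (a b c : nat) : nat := pcons a (pcons b (pcons c 0)).

Lemma p0E a b c : p0 (triple a b c) = a. Proof. exact: phd_pcons. Qed.
Lemma p1E a b c : p1 (triple a b c) = b.
Proof. by rewrite /p1 ptl_pcons phd_pcons. Qed.
Lemma p2E a b c : p2 (triple a b c) = c.
Proof. by rewrite /p2 !ptl_pcons phd_pcons. Qed.
Lemma p0_pcons a b : p0 (pcons a b) = a. Proof. exact: phd_pcons. Qed.
Lemma p1_pcons a b c : p1 (pcons a (pcons b c)) = b.
Proof. by rewrite /p1 ptl_pcons phd_pcons. Qed.
Definition pE := (p0E, p1E, p2E).

(** A preimage under the edge map is found by enumeration. Membership is tested beforehand, since
    outside the edge subgroup there would be nothing to find. *)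
Lemma pre_ex p : exists c, [|| fE [:: p0 p] == 0%N,
  fVG [:: c_src (p0 p) (p1 p); p2 p] == 0%N, ~~ c_in (p0 p) (p1 p) (p2 p) |
  (fEG [:: p0 p; c] != 0%N) && (c_dmap (p0 p) (p1 p) c == p2 p)].
Proof.
move: (p0 p) (p1 p) (p2 p) => m b n.
have [_|/fE_inv[e ->]] := eqVneq (fE [:: m]) 0%N; first by exists 0%N.
pose d : D := (e, b != 0%N).
have nz : ((b != 0%N : nat) != 0%N) = (b != 0%N) by case: (b).
have -> : c_src (ecode e) b = vcode (src d) by rewrite -c_srcE /c_src nz.
have [_|/fVG_inv[g ->]] := eqVneq (fVG [:: vcode (src d); n]) 0%N.
  by exists 0%N; rewrite orbT.
have -> : c_in (ecode e) b (vgcode g) = `[< esub d (single g) >].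
  by rewrite -c_inE single_same /c_in /c_lt /c_src nz.
case: asboolP => [[c _ cx]|_]; last by exists 0%N; rewrite !orbT.
exists (egcode c); have -> : c_dmap (ecode e) b (egcode c) = vgcode (dmap d c).
  by rewrite -c_dmapE /c_dmap nz.
by rewrite (fEG_code c) cx single_same eqxx !orbT.
Qed.

Definition c_pre (p : nat) : nat := ex_minn (pre_ex p).
Definition c_trans (p : nat) : nat := c_dmap (p0 p) (p1 p == 0%N) (c_pre p).

Lemma c_transE (d : D) (x : P) : esub d x ->
  c_trans (triple (ecode d.1) d.2 (vgcode (x (src d)))) =
  vgcode (dtrans d x (src (dinv d))).
Proof.
move=> xd; rewrite /c_trans /c_pre; case: ex_minnP => m; rewrite !pE.
rewrite fE_code c_srcE fVG_code c_inE asboolT //= => /andP[/(@fEG_inv d.1)[c ->]].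
rewrite c_dmapE => /eqP/(@vgcode_inj _ _ C _) cx _.
have -> : ((d.2 : nat) == 0%N) = ~~ d.2 by case: d.2.
by rewrite (@c_dmapE (dinv d) c) (dtransE (esym cx)) single_same.
Qed.

(** The final equality says that the coded list has exactly three entries. *)
Definition c_letter (a : nat) : bool :=
  ((p0 a == 0%N) && (fV [:: p1 a] != 0%N) && (fVG [:: p1 a; p2 a] != 0%N) ||
   (p0 a == 1%N) && (fE [:: p1 a] != 0%N) && (p2 a <= 1)) &&
  (a == triple (p0 a) (p1 a) (p2 a)).

Lemma c_letterP m : c_letter m <-> exists a : letter GG, m = letter_code C a.
Proof.
split=> [|[a ->]].
  rewrite /c_letter => /andP[h /eqP ->]; move: h.
  move: (p0 m) (p1 m) (p2 m) => {m} k m n /orP[|] /andP[/andP[/eqP ->]].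
    by move=> /fV_inv[v ->] /fVG_inv[g ->]; exists (Elt g).
  by move=> /fE_inv[e ->]; case: n => [|[|//]] _;
    [exists (Stab e false) | exists (Stab e true)].
case: a => [v g|e b].
  rewrite -[letter_code _ _]/(triple 0 (vcode v) (vgcode g)) /c_letter !pE.
  by rewrite fV_code fVG_code !eqxx.
rewrite -[letter_code _ _]/(triple 1 (ecode e) b) /c_letter !pE.
by rewrite fE_code !eqxx; case: (b).
Qed.

Definition c_word (m : nat) : nat :=
  foldl (fun st a => ((st != 0%N) && c_letter a : nat)) 1%N (CodeSeq.decode m).

Lemma c_wordP m : c_word m != 0%N <-> exists w : word GG, m = word_code C w.
Proof.
have allE (l : seq nat) st : (foldl (fun st a => ((st != 0%N) && c_letter a : nat)) st l
    != 0%N) = (st != 0%N) && all c_letter l.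
  elim: l st => [|a l IH] st /=; first by rewrite andbT.
  by rewrite IH andbA; case: (st != 0%N); case: (c_letter a).
rewrite /c_word allE /=; split=> [h|[w ->]].
  suff [w wE] : exists w : word GG, CodeSeq.decode m = map (letter_code C) w.
    by exists w; rewrite -[m]CodeSeq.decodeK wE.
  elim: (CodeSeq.decode m) h => [|a l IH] /=; first by exists [::].
  by move=> /andP[/c_letterP[a' ->] /IH[w ->]]; exists (a' :: w).
rewrite /word_code CodeSeq.codeK; elim: w => //= a w ->; rewrite andbT.
by apply/c_letterP; exists a.
Qed.

Definition c_letter_inv (a : nat) : nat :=
  if p0 a == 0%N then triple 0 (p1 a) (c_inv (p1 a) (p2 a))
  else triple 1 (p1 a) (p2 a == 0%N).

Lemma c_letter_invE (a : letter GG) :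
  c_letter_inv (letter_code C a) = letter_code C (letter_inv a).
Proof.
case: a => [v g|e b].
  rewrite -[letter_code _ _]/(triple 0 (vcode v) (vgcode g)) /c_letter_inv !pE /=.
  by rewrite c_invE.
rewrite -[letter_code _ _]/(triple 1 (ecode e) b) /c_letter_inv !pE /=.
by case: b.
Qed.

Definition c_invcat (u w : nat) : nat :=
  foldl (fun st a => pcons (c_letter_inv a) st) w (CodeSeq.decode u).

Lemma c_invcatE (u w : word GG) :
  c_invcat (word_code C u) (word_code C w) = word_code C (word_inv u ++ w).
Proof.
rewrite /c_invcat /word_code CodeSeq.codeK /word_inv.
elim: u w => //= a u IH w; rewrite c_letter_invE.
by rewrite (IH (letter_inv a :: w)) rev_cons cat_rcons.
Qed.

Definition c_rev (m : nat) : nat := foldl (fun st a => pcons a st) 0%N (CodeSeq.decode m).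

Lemma c_revE (w : word GG) : c_rev (word_code C w) = word_code C (rev w).
Proof.
rewrite /c_rev /word_code CodeSeq.codeK.
set F := (fun st a => _).
suff gen u : foldl F (CodeSeq.code (map (letter_code C) u)) (map (letter_code C) w) =
  CodeSeq.code (map (letter_code C) (catrev w u)) by exact: (gen [::]).
elim: w u => [|a w IH] u //=; exact: (IH (a :: u)).
Qed.

Definition c_erase (m : nat) : nat :=
  foldl (fun st a => if (p0 a == 1%N) && (fTree [:: p1 a] != 0%N) then st else pcons a st)
    0%N (CodeSeq.decode m).

Lemma c_eraseE (w : word GG) :
  c_erase (word_code C w) = word_code C (rev (erase_tree E0 w)).
Proof.
rewrite /c_erase /word_code CodeSeq.codeK.
set F := (fun st a => _).
suff gen u : foldl F (CodeSeq.code (map (letter_code C) u)) (map (letter_code C) w) =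
  CodeSeq.code (map (letter_code C) (catrev (erase_tree E0 w) u)) by exact: (gen [::]).
elim: w u => [|a w IH] u //=; rewrite {2}/F.
have -> : (p0 (letter_code C a) == 1%N) && (fTree [:: p1 (letter_code C a)] != 0%N)
    = tree_letter E0 a.
  case: a => [v g|e b].
    by rewrite -[letter_code _ _]/(triple 0 (vcode v) (vgcode g)) !pE.
  by rewrite -[letter_code _ _]/(triple 1 (ecode e) b) !pE fTreeE /=; case: asbool.
case: tree_letter => /=; first exact: IH.
exact: (IH (a :: u)).
Qed.

Lemma letter_code_inj : injective (letter_code C).
Proof.
case=> [v g|e b] [v' g'|e' b'] /(can_inj CodeSeq.codeK) //= [].
  by move=> /(@vcode_inj _ _ C) vE; subst v' => /(@vgcode_inj _ _ C _) ->.
by move=> /(@ecode_inj _ _ C) -> ; case: b b' => -[].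
Qed.

Lemma word_code_inj : injective (word_code C).
Proof. by move=> u w /(can_inj CodeSeq.codeK)/(inj_map letter_code_inj). Qed.

Local Notation inv := (@dinv Gam).
Local Notation cls := (@cls _ GG E0).
Local Notation tcls := (@tcls _ GG E0).
Local Notation gallery := (gallery inv src).
Local Notation eval := (eval inv src cls tcls).
Local Notation elt_lt := (elt_lt lti ltt).
Local Notation taut := (taut inv elt_lt dart_lt).
Local Notation turn := (turn elt_lt dart_lt).
Local Notation Phi := (Phi inv (@dfwd Gam) elt_lt dart_lt).
Implicit Types (l : seq (D * P)) (g : P) (v w : vertex Gam).

Definition entry (x : D * P) : nat :=
  triple (ecode x.1.1) x.1.2 (vgcode (x.2 (src (inv x.1)))).

Definition stack_code l : nat := CodeSeq.code (map entry l).

(* A state is the vertex where the path starts, its initial element, and the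
   list of the remaining (dart, element) pairs; 0 signals an error. *)
Definition state_code v g l : nat :=
  pcons (vcode v) (pcons (vgcode (g v)) (stack_code l)).

(** Left multiplication of g l by the dart d. If l starts with [inv d] and g lies in its edge
    subgroup, then d g (inv d) is the transport of g and merges with the next element; otherwise d
    is pushed with 1 in front of it. *)
Definition c_prepend (X e b : nat) : nat :=
  let g := p1 X in let l := ptl (ptl X) in let y := phd l in
  if [&& l != 0%N, p0 y == e, p1 y == (b == 0%N) & c_in e (b == 0%N) g] then
    pcons (c_src e b)
      (pcons (fVM [:: c_src e b; c_trans (triple e (b == 0%N) g); p2 y]) (ptl l))
  else pcons (c_src e b) (pcons (c_one (c_src e b)) (pcons (triple e b g) l)).

Definition c_step (X a : nat) : nat :=
  if X == 0%N then 0%N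
  else if p0 a == 0%N then
    if p1 a == p0 X then pcons (p0 X) (pcons (fVM [:: p0 X; p2 a; p1 X]) (ptl (ptl X)))
    else 0%N
  else if c_tgt (p1 a) (p2 a) == p0 X then c_prepend X (p1 a) (p2 a) else 0%N.

Lemma turn_elt_lt0 d d' g : turn d g d' = 0%Z <-> d = d' /\ esub d g.
Proof. exact: (turn_elt_lt lti_order ltt_order dart_lt_tri). Qed.

Lemma vcode_eq v w : (vcode v == vcode w) = `[< v = w >].
Proof. by case: asboolP => [->|n]; apply/eqP => // /(@vcode_inj _ _ C). Qed.

Lemma c_prependE (d : D) g l w : gallery (src (inv d)) l w -> taut l ->
  exists g' l', [/\ c_prepend (state_code (src (inv d)) g l) (ecode d.1) d.2
      = state_code (src d) g' l',
    gallery (src d) l' w, taut l'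
    & cls (src d) g' * eval l' = tcls d * (cls (src (inv d)) g * eval l)].
Proof.
move=> gl tl; rewrite /c_prepend /state_code.
cbv zeta; rewrite p1_pcons !ptl_pcons c_srcE c_oneE.
have -> : ((d.2 : nat) == 0%N) = (inv d).2 by rewrite /inv /=; case: d.2.
rewrite (c_inE (inv d)).
have push : ~ (exists g1 l1, l = (inv d, g1) :: l1 /\ esub (inv d) g) ->
  exists g' l',
   [/\ pcons (vcode (src d)) (pcons (vgcode (1 : vgrp GG (src d)))
        (pcons (triple (ecode d.1) d.2 (vgcode (g (src (inv d))))) (stack_code l)))
      = state_code (src d) g' l',
    gallery (src d) l' w, taut l'
    & cls (src d) g' * eval l' = tcls d * (cls (src (inv d)) g * eval l)].
  move=> nc; exists 1, ((d, g) :: l); split=> //.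
    split=> //; case: l tl gl nc => [|[d1 g1] l1] tl gl nc; [by left | right].
    by move=> /= /turn_elt_lt0 [dE eg]; apply: nc; exists g1, l1; rewrite -dE.
  by rewrite (cls1 (@clsM _ GG E0)) mul1g /= mulgA.
case: l gl tl push => [|[d1 g1] l1] gl tl push.
  by apply: push => -[? [? []]].
rewrite /stack_code /= -/(stack_code _) -/(pcons _ _) pcons_eq0 phd_pcons ptl_pcons !pE.
case: ifPn => [/and4P[_ /eqP/(@ecode_inj _ _ C) eE /eqP bE /asboolP eg]|nc]; last first.
  apply: push => -[g2 [l2 [[dE _ _] eg]]]; case/negP: nc.
  by rewrite dE !eqxx asboolT.
have dE : d1 = inv d.
  case: d1 d eE bE {gl tl push eg} => [e1 b1] [e b] /= ->; rewrite /inv /=.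
  by case: b1 b => -[].
subst d1; case: gl => _ gl; case: tl => _ tl {eE bE push}.
have iE : src (inv (inv d)) = src d by rewrite dinvK.
exists (dtrans (inv d) g * g1), l1; split=> //.
- rewrite (c_transE eg) /state_code; congr pcons; congr pcons.
  by case: d g1 g {gl tl eg iE} => e [] g1 g; rewrite fVME.
- by rewrite -iE.
- have := @cls_tcls _ GG E0 _ _ eg; rewrite iE => h; move: (cls (src (inv d)) g) h => c h.
  rewrite !(mulgA c) h (@clsM _ GG E0) tcls_inv.
  by rewrite -!mulgA mulVKg.
Qed.

Lemma c_stepE (a : letter GG) v g l w : gallery v l w -> taut l ->
  (letter_tgt a <> v -> c_step (state_code v g l) (letter_code C a) = 0%N) /\
  (letter_tgt a = v -> exists g' l',
    [/\ c_step (state_code v g l) (letter_code C a) = state_code (letter_src a) g' l',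
      gallery (letter_src a) l' w, taut l'
      & cls (letter_src a) g' * eval l' = word_class E0 [:: a] * (cls v g * eval l)]).
Proof.
move=> gl tl; rewrite /c_step pcons_eq0.
have -> : p0 (state_code v g l) = vcode v by exact: p0_pcons.
case: a => [x h|e b].
  rewrite -[letter_code _ _]/(triple 0 (vcode x) (vgcode h)) !pE vcode_eq /=.
  case: asboolP => [xv|nxv]; split=> // _; subst x.
  exists (single h * g), l; split=> //.
    rewrite /state_code p1_pcons !ptl_pcons fVME; congr (pcons _ (pcons (vgcode _) _)).
    by rewrite -{1}(single_same h).
  by rewrite (@clsM _ GG E0) mulgA {1}/cls single_same.
rewrite -[letter_code _ _]/(triple 1 (ecode e) b) !pE (c_tgtE (e, b)) vcode_eq.
rewrite [(1 == 0)%N]/=.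
case: asboolP => [xv|nxv]; split=> // _; subst v.
have [g' [l' [sE gl' tl' cE']]] := @c_prependE (e, b) g l w gl tl.
by exists g', l'; split.
Qed.

(** Letters are prepended to the path, so a word is consumed from its last letter; this is the
    origin of the reversals below. *)
Definition c_run (v z : nat) : nat :=
  foldl c_step (pcons v (pcons (c_one v) 0)) (CodeSeq.decode z).

Lemma c_run0 s : foldl c_step 0%N s = 0%N.
Proof. by elim: s => //= a s IH; rewrite {2}/c_step eqxx. Qed.

Lemma c_run_start v : pcons (vcode v) (pcons (c_one (vcode v)) 0) = state_code v 1 [::].
Proof. by rewrite c_oneE. Qed.

Lemma c_run_sound v (z : word GG) : c_run (vcode v) (word_code C z) != 0%N ->
  exists v' g l, [/\ c_run (vcode v) (word_code C z) = state_code v' g l,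
    gallery v' l v, taut l & word_class E0 (rev z) = cls v' g * eval l].
Proof.
rewrite /c_run /word_code CodeSeq.codeK c_run_start.
pose ok X z' := exists v' g l, [/\ X = state_code v' g l, gallery v' l v, taut l
  & word_class E0 (rev z') = cls v' g * eval l].
suff gen z1 z2 X : ok X z1 -> foldl c_step X (map (letter_code C) z2) != 0%N ->
    ok (foldl c_step X (map (letter_code C) z2)) (z1 ++ z2).
  apply: (gen [::]); exists v, 1, [::]; split=> //.
  by rewrite (cls1 (@clsM _ GG E0)) mulg1.
elim: z2 z1 X => [|a z2 IH] z1 X; first by rewrite cats0.
rewrite -cat_rcons /= => -[v' [g [l [-> gl tl xE]]]] nz; apply: IH => //.
have [h0 h1] := c_stepE a g gl tl.
have [av|nav] := pselect (letter_tgt a = v'); last first.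
  by move: nz; rewrite h0 // c_run0 eqxx.
have [g' [l' [sE gl' tl' xE']]] := h1 av.
exists (letter_src a), g', l'; split=> //.
by rewrite rev_rcons -cat1s word_class_cat xE xE'.
Qed.

Lemma c_run_complete v x (p : word GG) : path_word x p v ->
  exists g l, c_run (vcode v) (word_code C (rev p)) = state_code x g l.
Proof.
rewrite /c_run /word_code CodeSeq.codeK c_run_start => pw.
suff [g [l [-> _ _]]] : exists g l, [/\ foldl c_step (state_code v 1 [::])
    (map (letter_code C) (rev p)) = state_code x g l, gallery x l v & taut l].
  by exists g, l.
elim: p x pw => [|a p IH] x /=; first by move=> ->; exists 1, [::].
case=> <- /IH[g [l [sE gl tl]]]; rewrite rev_cons map_rcons foldl_rcons sE.
have [_ /(_ erefl)[g' [l' [-> gl' tl' _]]]] := c_stepE a g gl tl.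
by exists g', l'.
Qed.

(* [z] is the reversal of a path word that differs from [m] only by letters of the
   maximal tree. *)
Lemma find_ex (v m : nat) : exists z, (fV [:: v] == 0%N) || (c_word m == 0%N) ||
  [&& c_word z != 0%N, c_run v z != 0%N, p0 (c_run v z) == v
    & c_erase z == c_erase (c_rev m)].
Proof.
have [_|/fV_inv[w ->]] := eqVneq (fV [:: v]) 0%N; first by exists 0%N.
have [_|/c_wordP[u ->]] := eqVneq (c_word m) 0%N; first by exists 0%N; rewrite orbT.
(* Connectedness of the tree is used only to guarantee that the search ends; no tree walk is
   computed from the vertices. *)
have [p [pw pE]] := path_word_ex u (tree_connected Gam_connected T_maximal) w w.
have [g [l rE]] := c_run_complete pw.
exists (word_code C (rev p)); rewrite rE pcons_eq0 p0_pcons eqxx /=.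
rewrite c_revE !c_eraseE /erase_tree !filter_rev -!/(erase_tree E0 _) pE eqxx andbT.
by apply/c_wordP; exists (rev p).
Qed.

Definition c_path (v m : nat) : nat := c_run v (ex_minn (find_ex v m)).

(** Whichever word the search returns, its nonzero run certifies a reduced path with the same value,
    and tree letters, the only difference from u, have value 1. *)
Lemma c_pathE v (u : word GG) : exists g l,
  [/\ c_path (vcode v) (word_code C u) = state_code v g l,
    gallery v l v, taut l & word_class E0 u = cls v g * eval l].
Proof.
have cu : c_word (word_code C u) != 0%N by apply/c_wordP; exists u.
rewrite /c_path; case: ex_minnP => z; rewrite fV_code (negbTE cu) [(1 == 0)%N]/= !orFb.
move=> /and4P[/c_wordP[w ->] /c_run_sound[v' [g [l [-> gl tl xE]]]]].
rewrite p0_pcons => /eqP/(@vcode_inj _ _ C) vE; subst v'.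
rewrite c_revE !c_eraseE => /eqP/word_code_inj/(can_inj revK) eE _.
exists g, l; split=> //; rewrite -xE -[LHS](word_class_erase E0) -[RHS](word_class_erase E0).
by rewrite /erase_tree filter_rev -!/(erase_tree E0 _) eE /erase_tree filter_rev revK.
Qed.

(** The sign is shifted by one to the values 0, 1, 2, so as to stay in [nat]. When the way back
    along y and the next dart coincide, the coset order decides; otherwise the order of darts
    does. *)
Definition c_turn (y a : nat) : nat :=
  if (p0 y == p0 a) && ((p1 y == 0%N) == (p1 a != 0%N)) then
    if c_lt (p0 y) (p1 y == 0%N) (c_one (c_src (p0 y) (p1 y == 0%N))) (p2 y) != 0%N
    then 2%N
    else if c_lt (p0 y) (p1 y == 0%N) (p2 y) (c_one (c_src (p0 y) (p1 y == 0%N))) != 0%N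
    then 0%N else 1%N
  else if (p0 y).*2 + (p1 y == 0%N) < (p0 a).*2 + p1 a then 2%N else 0%N.

Lemma c_turnE (x y : D * P) :
  Z.of_nat (c_turn (entry x) (entry y)) = (1 + turn (inv x.1) x.2 y.1)%Z.
Proof.
case: x y => [d g] [d' g']; rewrite /c_turn /entry !pE.
have -> : ((d.2 : nat) == 0%N) = (inv d).2 by rewrite /inv /=; case: d.2.
rewrite -[ecode d.1]/(ecode (inv d).1) c_srcE c_oneE.
rewrite -[vgcode 1]/(vgcode ((1 : P) (src (inv d)))) !c_ltE.
have -> : ((d'.2 : nat) != 0%N) = d'.2 by case: d'.2.
rewrite [(_, _).1]/= [(_, _).2]/=; move: (inv d) => {}d.
have -> : (ecode d.1 == ecode d'.1) && (d.2 == d'.2) = `[< d = d' >].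
  case: asboolP => [->|n]; first by rewrite !eqxx.
  apply/negP => /andP[/eqP/(@ecode_inj _ _ C) e1 /eqP e2]; apply: n.
  by case: d d' e1 e2 => [e b] [e' b'] /= -> ->.
rewrite /turn /link_cmp /link_lt /=.
case: asboolP => [dE|nd].
  subst d'; have irr : ~ dart_lt d d by rewrite /dart_lt ltnn.
  have E x y : `[< dart_lt d d \/ d = d /\ elt_lt d x y >] = `[< elt_lt d x y >].
    by apply: asbool_equiv_eq; tauto.
  by rewrite !E; case: asbool => //; case: asbool.
have E d1 d2 x y : d1 <> d2 -> `[< dart_lt d1 d2 \/ d1 = d2 /\ elt_lt d1 x y >] =
    ((ecode d1.1).*2 + d1.2 < (ecode d2.1).*2 + d2.2).
  by move=> n; rewrite -[RHS]asboolb; apply: asbool_equiv_eq; rewrite /dart_lt; tauto.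
rewrite E // E; last by move/esym.
case: (dart_lt_tri d d'); rewrite /dart_lt => -[h1 h2 h3] //; first by rewrite h1.
by rewrite (negbTE (introN idP h1)) h3.
Qed.

(** Positive and negative terms are counted separately, in place of integers. The third component is
    the previous entry; its value 0 marks the start, where there is no turn. *)
Definition c_phi_step (_ st a : nat) : nat :=
  let y := ptl (ptl st) in
  pcons (p0 st + (p1 a != 0%N) + ((y != 0%N) && (c_turn y a == 2%N)))
    (pcons (p1 st + (p1 a == 0%N) + ((y != 0%N) && (c_turn y a == 0%N))) a).

Definition c_phi (m : nat) : nat := foldl (c_phi_step 0) (pcons 0 (pcons 0 0)) (CodeSeq.decode m).

Definition c_pos (m : nat) : bool := p1 (c_phi m) < p0 (c_phi m).

Lemma c_posE l : c_pos (stack_code l) <-> (Phi l > 0)%Z.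
Proof.
pose val st := (Z.of_nat (p0 st) - Z.of_nat (p1 st))%Z.
have stepE m n (y : nat) (x : D * P) (z : Z) :
    z = (if y == 0%N then 0%Z else (Z.of_nat (c_turn y (entry x)) - 1)%Z) ->
    (-1 <= z <= 1)%Z -> exists m' n',
    c_phi_step 0 (pcons m (pcons n y)) (entry x) = pcons m' (pcons n' (entry x)) /\
    (Z.of_nat m' - Z.of_nat n' =
     Z.of_nat m - Z.of_nat n + sgn (@dfwd Gam) x.1 + z)%Z.
  rewrite /c_phi_step !ptl_pcons p0_pcons p1_pcons.
  have -> : p1 (entry x) = x.1.2 :> nat by rewrite p1E.
  set b : bool := x.1.2; rewrite /sgn /dfwd -/b => zE hz.
  exists (m + ((b : nat) != 0) + ((y != 0) && (c_turn y (entry x) == 2)))%N.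
  exists (n + ((b : nat) == 0) + ((y != 0) && (c_turn y (entry x) == 0)))%N.
  split=> //; rewrite -!plusE !Nat2Z.inj_add.
  move: hz; rewrite zE; case: (y == 0%N) => /=; first by case: b => /=; lia.
  case: (c_turn y (entry x)) => [|[|[|k]]]; try by case: b => /=; lia.
  by rewrite !Nat2Z.inj_succ => h; exfalso; lia.
have turn_bound d g d' : (-1 <= turn d g d' <= 1)%Z.
  by rewrite /turn; case: (link_cmpP (elt_lt_tri lti_order ltt_order) dart_lt_tri).
have foldE1 l1 m n (x : D * P) :
    val (foldl (c_phi_step 0) (pcons m (pcons n (entry x))) (map entry l1)) =
    (Z.of_nat m - Z.of_nat n + turn_to elt_lt dart_lt (inv x.1) x.2 l1 + Phi l1)%Z.
  elim: l1 m n x => [|[d g] l1 IH] m n x.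
    by rewrite /= /val p0_pcons p1_pcons; lia.
  have := stepE m n (entry x) (d, g) (turn (inv x.1) x.2 d).
  rewrite pcons_eq0 c_turnE [(d, g).1]/=.
  case; [by lia | exact: turn_bound | move=> m' [n' [sE vE]]].
  rewrite [map _ _]/= [foldl _ _ _]/= sE IH vE.
  rewrite [(d, g).1]/= [(d, g).2]/= [turn_to _ _ (inv x.1) _ _]/= [Phi (_ :: _)]/=; lia.
have -> : Phi l = val (c_phi (stack_code l)).
  rewrite /c_phi /stack_code CodeSeq.codeK; case: l => [|[d g] l].
    by rewrite /= /val p0_pcons p1_pcons.
  have z0 : (-1 <= 0 <= 1)%Z by lia.
  have [m [n [sE vE]]] := stepE 0%N 0%N 0%N (d, g) 0%Z erefl z0.
  by rewrite [map _ _]/= [foldl _ _ _]/= sE foldE1 vE /=; lia.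
rewrite /c_pos /val; split=> [/ltP|h]; first by lia.
by apply/ltP; lia.
Qed.

Definition c_out (v u w : nat) : bool := c_pos (ptl (ptl (c_path v (c_invcat u w)))).

Lemma word_class_invcat (u w : word GG) : word_class E0 (word_inv u ++ w) =
  ((word_class E0 u : fundamental_group GG E0)^-1 * word_class E0 w)%g.
Proof. by rewrite word_class_cat -fg_invE. Qed.

Local Notation fg_positive := (@fg_positive _ GG E0 lti ltt dart_lt).

Let fg_positive_cone := fg_positive_cone Gam_connected T_maximal lti_order ltt_order
  dart_lt_trans dart_lt_tri.

Lemma c_outE v (u w : word GG) : c_out (vcode v) (word_code C u) (word_code C w) <->
  fg_positive v ((word_class E0 u)^-1 * word_class E0 w).
Proof.
rewrite /c_out c_invcatE; have [g [l [-> gl tl xE]]] := c_pathE v (word_inv u ++ w).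
rewrite /state_code !ptl_pcons c_posE -word_class_invcat.
have cp := fg_positive_cone v; rewrite vertex_subgroupE in cp.
apply: iff_sym; apply: (positive_eltsE (@dinvK Gam) (@dfwd_inv Gam) (@esub_subgroup _ GG)
  (elt_lt_tri lti_order ltt_order) (elt_ltM lti_order ltt_order) dart_lt_tri
  (@clsM _ GG E0) (@tcls_inv _ GG E0) cp).
by split=> //; exists g.
Qed.


(** * Computability of the algorithms *)

Section Computations.
Implicit Types a b c : seq nat -> nat.

Ltac comp_basic := first
  [ assumption | progress cbv beta | simple apply comp_nth | simple apply comp_const
  | simple apply comp_if | simple apply comp_andb | simple apply comp_orb
  | simple apply comp_eq0 | simple apply comp_neq0 | simple apply comp_eq | simple apply comp_leq
  | simple apply comp_negb | simple apply comp_eqb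
  | simple apply comp_pcons | simple apply comp_phd | simple apply comp_ptl
  | simple apply comp_S | simple apply comp_add
  | simple apply (fun a => @comp_list1 O _ a cV)
  | simple apply (fun a => @comp_list1 O _ a cE)
  | simple apply (fun a => @comp_list1 O _ a cI)
  | simple apply (fun a => @comp_list1 O _ a cT)
  | simple apply (fun a => @comp_list1 O _ a cTree)
  | simple apply (fun a b => @comp_list2 O _ a b cVG)
  | simple apply (fun a b => @comp_list2 O _ a b cEG)
  | simple apply (fun a b => @comp_list2 O _ a b cIM)
  | simple apply (fun a b => @comp_list2 O _ a b cTM)
  | simple apply (fun a b c => @comp_list3 O _ a b c cVM)
  | simple apply (fun a b c => @comp_list3 O _ a b c cLI)
  | simple apply (fun a b c => @comp_list3 O _ a b c cLT) ].

Lemma comp_c_src a b : comp a -> comp b -> comp (fun s => c_src (a s) (b s)).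
Proof. by move=> ha hb; rewrite /c_src; repeat comp_basic. Qed.

Lemma comp_c_tgt a b : comp a -> comp b -> comp (fun s => c_tgt (a s) (b s)).
Proof. by move=> ha hb; rewrite /c_tgt; repeat comp_basic. Qed.

Lemma comp_c_dmap a b c : comp a -> comp b -> comp c ->
  comp (fun s => c_dmap (a s) (b s) (c s)).
Proof. by move=> ha hb hc; rewrite /c_dmap; repeat comp_basic. Qed.

Lemma comp_c_lt a b c d : comp a -> comp b -> comp c -> comp d ->
  comp (fun s => c_lt (a s) (b s) (c s) (d s)).
Proof. by move=> ha hb hc hd; rewrite /c_lt; repeat comp_basic. Qed.

Lemma comp_c_one a : comp a -> comp (fun s => c_one (a s)).
Proof. by apply: (comp_ex_minn1 one_ex); repeat comp_basic. Qed.

Lemma comp_c_inv a b : comp a -> comp b -> comp (fun s => c_inv (a s) (b s)).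
Proof. by apply: (comp_ex_minn2 inv_ex); repeat comp_basic. Qed.

Lemma comp_p0 a : comp a -> comp (fun s => p0 (a s)).
Proof. by move=> ha; rewrite /p0; repeat comp_basic. Qed.

Lemma comp_p1 a : comp a -> comp (fun s => p1 (a s)).
Proof. by move=> ha; rewrite /p1; repeat comp_basic. Qed.

Lemma comp_p2 a : comp a -> comp (fun s => p2 (a s)).
Proof. by move=> ha; rewrite /p2; repeat comp_basic. Qed.

Lemma comp_triple a b c : comp a -> comp b -> comp c ->
  comp (fun s => triple (a s) (b s) (c s)).
Proof. by move=> ha hb hc; rewrite /triple; repeat comp_basic. Qed.

Lemma comp_c_in a b c : comp a -> comp b -> comp c ->
  comp (fun s => c_in (a s) (b s) (c s) : nat).
Proof.
move=> ha hb hc; rewrite /c_in.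
by repeat first [comp_basic | simple apply comp_c_lt | simple apply comp_c_one
  | simple apply comp_c_src].
Qed.

Ltac comp_auto := repeat first
  [ comp_basic | simple apply comp_c_lt | simple apply comp_c_one | simple apply comp_c_src
  | simple apply comp_c_tgt | simple apply comp_c_dmap | simple apply comp_c_inv
  | simple apply comp_c_in
  | simple apply comp_p0 | simple apply comp_p1 | simple apply comp_p2 | simple apply comp_triple ].

Lemma comp_c_trans a : comp a -> comp (fun s => c_trans (a s)).
Proof.
move=> ha; rewrite /c_trans; comp_auto; move: a ha.
by apply: (comp_ex_minn1 pre_ex); comp_auto.
Qed.

Lemma comp_c_letter a : comp a -> comp (fun s => c_letter (a s) : nat).
Proof. by move=> ha; rewrite /c_letter; comp_auto. Qed.

Lemma comp_c_word a : comp a -> comp (fun s => c_word (a s)).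
Proof.
move=> ha; apply: (comp_foldl (F := fun _ st x => ((st != 0%N) && c_letter x : nat))
  _ (comp_const O 0) (comp_const O 1) ha).
by comp_auto; apply: comp_c_letter; comp_auto.
Qed.

Lemma comp_c_invcat a b : comp a -> comp b -> comp (fun s => c_invcat (a s) (b s)).
Proof.
move=> ha hb; apply: (comp_foldl (F := fun _ st x => pcons (c_letter_inv x) st)
  _ (comp_const O 0) hb ha).
by rewrite /c_letter_inv; comp_auto.
Qed.

Lemma comp_c_rev a : comp a -> comp (fun s => c_rev (a s)).
Proof.
move=> ha; apply: (comp_foldl (F := fun _ st x => pcons x st)
  _ (comp_const O 0) (comp_const O 0) ha).
by comp_auto.
Qed.

Lemma comp_c_erase a : comp a -> comp (fun s => c_erase (a s)).
Proof.
move=> ha; apply: (comp_foldl (F := fun _ st x =>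
  if (p0 x == 1%N) && (fTree [:: p1 x] != 0%N) then st else pcons x st)
  _ (comp_const O 0) (comp_const O 0) ha).
by comp_auto.
Qed.

Lemma comp_c_run a b : comp a -> comp b -> comp (fun s => c_run (a s) (b s)).
Proof.
move=> ha hb; apply: (comp_foldl (F := fun _ => c_step)
  _ (comp_const O 0) _ hb); last by comp_auto.
rewrite /c_step /c_prepend; cbv zeta.
by repeat first [progress comp_auto | simple apply comp_c_trans].
Qed.

Lemma comp_c_path a b : comp a -> comp b -> comp (fun s => c_path (a s) (b s)).
Proof.
move=> ha hb; apply: comp_c_run => //; move: a b ha hb.
apply: (comp_ex_minn2 find_ex).
by repeat first [progress comp_auto | simple apply comp_c_word | simple apply comp_c_run
  | simple apply comp_c_erase | simple apply comp_c_rev].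
Qed.

Lemma comp_c_turn a b : comp a -> comp b -> comp (fun s => c_turn (a s) (b s)).
Proof.
move=> ha hb; rewrite /c_turn.
have dbl x : comp x -> comp (fun s => (x s).*2).
  by move=> hx; apply: comp_ext (comp_add hx hx) => s; rewrite addnn.
by repeat first [progress comp_auto | simple apply dbl].
Qed.

Lemma comp_c_pos a : comp a -> comp (fun s => c_pos (a s) : nat).
Proof.
have hphi x : comp x -> comp (fun s => c_phi (x s)).
  move=> hx; apply: (comp_foldl (F := c_phi_step) _ (comp_const O 0) _ hx);
    last by comp_auto.
  rewrite /c_phi_step; cbv zeta.
  by repeat first [progress comp_auto | simple apply comp_c_turn].
by move=> ha; rewrite /c_pos; repeat first [progress comp_auto | simple apply hphi].
Qed.

End Computations.

Lemma effective_cone_orders :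
  effective_output_orders O C (fun v => cone_lt (fg_positive v)).
Proof.
exists (fun s => c_out (nth 0 s 0) (nth 0 s 1) (nth 0 s 2) : nat)%N; last first.
  move=> v u w; congr nat_of_bool; rewrite -[LHS]asboolb; apply: asbool_equiv_eq.
  rewrite c_outE; apply: iff_sym; have cp := fg_positive_cone v.
  by apply: cone_ltE => //; case: cp.
apply: comp_c_pos; do 2!apply: comp_ptl; apply: comp_c_path; first exact: comp_nth.
by apply: comp_c_invcat; exact: comp_nth.
Qed.

(** When the computed path is empty, the quotient lies in the vertex group and the leading element
    of the state represents it there, by injectivity of the vertex group; the given left order then
    decides. *)
Lemma effective_fg_lt v (ltv : vgrp GG v -> vgrp GG v -> Prop) :
  effective_vertex_left_order O C ltv ->
  effective_left_order O C (@fg_lt _ GG E0 lti ltt dart_lt v ltv).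
Proof.
case=> fLV cLV fLVE.
pose path (u w : nat) := c_path (vcode v) (c_invcat u w).
pose F (u w : nat) := c_pos (ptl (ptl (path u w))) || (ptl (ptl (path u w)) == 0%N) &&
  (fLV [:: c_one (vcode v); p1 (path u w)] != 0%N).
have hpath : comp (fun s => path (nth 0 s 0) (nth 0 s 1))%N.
  apply: comp_c_path; first exact: comp_const.
  by apply: comp_c_invcat; exact: comp_nth.
have hptl := comp_ptl (comp_ptl hpath).
exists (fun s => F (nth 0 s 0) (nth 0 s 1) : nat)%N.
  apply: comp_orb (comp_c_pos hptl) _; apply: comp_andb (comp_eq0 hptl) _.
  apply: comp_neq0; apply: (comp_list2 cLV); last exact: comp_p1.
  exact: comp_const.
move=> u w /=; congr nat_of_bool; rewrite -[LHS]asboolb; apply: asbool_equiv_eq.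
rewrite /F /path -/(c_out _ _ _) /fg_lt -c_outE.
rewrite c_invcatE -word_class_invcat.
have [g [l [-> gl tl xE]]] := c_pathE v (word_inv u ++ w).
rewrite p1_pcons !ptl_pcons c_oneE fLVE xE.
have pP := c_outE v u w; rewrite -word_class_invcat in pP.
split=> [/orP[|]|]; first by left.
  case: l gl tl xE => [|x l] gl tl xE /=; last by rewrite /stack_code /= pcons_eq0.
  by case: asboolP => // lt1g _; right; exists (g v) => //; rewrite mulg1.
case=> [->//|[h lt1h hE]]; apply/orP; right.
have kE : 1 = cls v (single h^-1 * g) * eval l.
  rewrite (@clsM _ GG E0) -mulgA hE singleV (clsV (@clsM _ GG E0)).
  by rewrite /cls single_same mulVg.
have [l0 gv] := tpath1 (tree_connected Gam_connected T_maximal)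
  (tree_acyclic T_maximal) turn_elt_lt0 gl tl kE.
rewrite l0 asboolT //; suff <- : h = g v by [].
apply: (@mulgI _ h^-1); rewrite mulVg -gv.
by rewrite -{2}(single_same h^-1).
Qed.

End Algorithm.

Theorem theorem17 (Gam : graph) (GG : graph_of_groups Gam)
    (V0 : set (vertex Gam)) (E0 : set (edge Gam))
    (Gam_connected : connected_graph Gam)
    (T_maximal : maximal_subtree V0 E0)
    (init_convex : forall e, left_relatively_convex (range (init_map GG e)))
    (term_convex : forall e, left_relatively_convex (range (term_map GG e))) :
  [/\ forall v, left_relatively_convex (vertex_subgroup GG E0 v),
      (exists v, left_orderable (vgrp GG v)) ->
        left_orderable (fundamental_group GG E0)
    & forall (O : set (nat -> nat)) (C : coding GG)
        (C_eff : effective_coding O E0 C)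
        (lti : forall e,
           set (vgrp GG (init e)) -> set (vgrp GG (init e)) -> Prop)
        (ltt : forall e,
           set (vgrp GG (term e)) -> set (vgrp GG (term e)) -> Prop)
        (lti_order : forall e, coset_order (range (init_map GG e)) (lti e))
        (ltt_order : forall e, coset_order (range (term_map GG e)) (ltt e))
        (lti_eff : effective_init_orders O C lti)
        (ltt_eff : effective_term_orders O C ltt),
        (exists lt : forall v : vertex Gam, set (fundamental_group GG E0) ->
             set (fundamental_group GG E0) -> Prop,
           (forall v, coset_order (vertex_subgroup GG E0 v) (lt v)) /\
           effective_output_orders O C lt) /\
        (forall (v : vertex Gam) (ltv : vgrp GG v -> vgrp GG v -> Prop),
           left_order ltv -> effective_vertex_left_order O C ltv ->
           exists lt : fundamental_group GG E0 ->
               fundamental_group GG E0 -> Prop,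
             left_order lt /\ effective_left_order O C lt)].
Proof.
split.
(* Without codes, the total order of the darts comes from the well-ordering principle. *)
- have [dlt [dlt_trans dlt_tri]] := total_order_exists (dart Gam).
  move=> v; eexists; apply: cone_coset_order.
  exact: (fg_positive_cone Gam_connected T_maximal
    (fun e => projT2 (cid (init_convex e))) (fun e => projT2 (cid (term_convex e)))
    dlt_trans dlt_tri v).
- have [dlt [dlt_trans dlt_tri]] := total_order_exists (dart Gam).
  case=> v [ltv ltv_order]; eexists.
  exact: (fg_lt_order Gam_connected T_maximal
    (fun e => projT2 (cid (init_convex e))) (fun e => projT2 (cid (term_convex e)))
    dlt_trans dlt_tri ltv_order).
- move=> O C [[fV cV fVE] [fE cE fEE] [fVG cVG fVGE] [fEG cEG fEGE] [fI cI fIE]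
    [fT cT fTE] [fTree cTree fTreeE] [fVM cVM fVME] _ [fIM cIM fIME] [fTM cTM fTME]].
  move=> lti ltt lti_order ltt_order [fLI cLI fLIE] [fLT cLT fLTE].
  (* Here the darts are ordered by their codes, which makes the same construction decidable. *)
  have dtrans := @dart_lt_trans _ _ C; have dtri := @dart_lt_tri _ _ C.
  split=> [|v ltv ltv_order ltv_eff].
    exists (fun v => cone_lt (fg_positive lti ltt (dart_lt C) v)); split.
      move=> v; apply: cone_coset_order.
      exact: (fg_positive_cone Gam_connected T_maximal lti_order ltt_order dtrans dtri v).
    exact: (effective_cone_orders Gam_connected T_maximal lti_order ltt_order
      cV cE cVG cEG cI cT cTree cVM cIM cTM cLI cLT
      fVE fEE fVGE fEGE fIE fTE fTreeE fVME fIME fTME fLIE fLTE).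
  exists (fg_lt lti ltt (dart_lt C) ltv); split.
    exact: (fg_lt_order Gam_connected T_maximal lti_order ltt_order dtrans dtri ltv_order).
  exact: (effective_fg_lt Gam_connected T_maximal lti_order ltt_order
    cV cE cVG cEG cI cT cTree cVM cIM cTM cLI cLT
    fVE fEE fVGE fEGE fIE fTE fTreeE fVME fIME fTME fLIE fLTE ltv_eff).
Qed.
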